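(* Let $f$ and $g$ be transcendental entire functions with $f\circ g=g\circ f$, let $h$ be a transcendental entire function and $P$ a polynomial of degree at least $2$ such that $P\circ f=h\circ g$. If $z_0\in F(f)\cap BU(f)$, then every $w\in\mathbb{C}$ with $g(w)=z_0$ satisfies $w\in F(f)\cap BU(f)$.
   Context: For an entire function $f$, $f^n$ denotes the $n$-th iterate. The Fatou set $F(f)$ is the set of points having a neighbourhood on which $\{f^n\}$ is normal, and $J(f)=\mathbb{C}\setminus F(f)$ is the Julia set. The escaping set is $I(f)=\{z: f^n(z)\to\infty\}$, $K(f)=\{z: \exists R>0,\ |f^n(z)|\le R\ \forall n\ge0\}$, and the Bungee set is $BU(f)=\mathbb{C}\setminus(I(f)\cup K(f))$. *)

(* Defs.v *)
From Stdlib Require Import Reals.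
From Coquelicot Require Import Coquelicot.
Open Scope R_scope.

Definition entire (f : C -> C) : Prop :=
  forall z : C, ex_derive (K := C_AbsRing) (V := C_NormedModule) f z.

Fixpoint Cpow (z : C) (n : nat) : C :=
  match n with O => RtoC 1 | S m => Cmult z (Cpow z m) end.

Fixpoint polyval (a : nat -> C) (n : nat) (z : C) : C :=
  match n with
  | O => a O
  | S m => Cplus (polyval a m z) (Cmult (a (S m)) (Cpow z (S m)))
  end.

Definition is_polynomial (P : C -> C) : Prop :=
  exists (a : nat -> C) (n : nat), forall z, P z = polyval a n z.

Definition poly_of_degree (P : C -> C) (n : nat) : Prop :=
  exists a : nat -> C, a n <> RtoC 0 /\ forall z, P z = polyval a n z.

Definition transcendental_entire (f : C -> C) : Prop :=
  entire f /\ ~ is_polynomial f.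

Definition iterate (f : C -> C) (n : nat) (z : C) : C := Nat.iter n f z.

Definition loc_unif_cv (F : nat -> C -> C) (g : C -> C) (U : C -> Prop) : Prop :=
  forall z, U z -> exists r : R, 0 < r /\
    forall eps : R, 0 < eps -> exists N : nat, forall k w, (N <= k)%nat ->
      Cmod (Cminus w z) < r -> Cmod (Cminus (F k w) (g w)) < eps.

Definition loc_unif_cv_infty (F : nat -> C -> C) (U : C -> Prop) : Prop :=
  forall z, U z -> exists r : R, 0 < r /\
    forall M : R, exists N : nat, forall k w, (N <= k)%nat ->
      Cmod (Cminus w z) < r -> M < Cmod (F k w).

Definition iterates_normal_on (f : C -> C) (U : C -> Prop) : Prop :=
  forall m : nat -> nat, exists phi : nat -> nat,
    (forall k, (phi k < phi (S k))%nat) /\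
    ((exists g : C -> C,
        loc_unif_cv (fun k => iterate f (m (phi k))) g U) \/
     loc_unif_cv_infty (fun k => iterate f (m (phi k))) U).

Definition in_Fatou (f : C -> C) (z : C) : Prop :=
  exists r : R, 0 < r /\ iterates_normal_on f (fun w => Cmod (Cminus w z) < r).

Definition in_Julia (f : C -> C) (z : C) : Prop := ~ in_Fatou f z.

Definition in_I (f : C -> C) (z : C) : Prop :=
  forall M : R, exists N : nat, forall n, (N <= n)%nat -> M < Cmod (iterate f n z).

Definition in_K (f : C -> C) (z : C) : Prop :=
  exists R0 : R, 0 < R0 /\ forall n, Cmod (iterate f n z) <= R0.

Definition in_BU (f : C -> C) (z : C) : Prop := ~ in_I f z /\ ~ in_K f z.

(* Main.v *)
Require Import Defs.
From Stdlib Require Import Reals Lra Lia List Classical ClassicalEpsilon Cantor.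
From Coquelicot Require Import Coquelicot.
Open Scope R_scope.

(* Since f^n(g w) = g(f^n w), bounded orbits of w give bounded orbits of g w, and
   P(f^(n+1) w) = h(f^n(g w)) with P proper shows that an escaping w has an
   escaping image; hence w is in BU(f).
   For the Fatou part, let f^(m_k) converge near g w. If the limit is infinity,
   then g(f^(m_k)) tends to infinity near w, and so does f^(m_k). If the limit is
   finite, then g(f^(m_k)) is bounded near w, so f^(m_k) omits there a fixed disc
   on which |g| is large (it exists by Liouville), and families omitting a disc
   are normal: F_k = f^(m_k) yields bounded zero-free functions rho / (F_k - a),
   which by a Harnack-type inequality are either locally bounded below along a
   subsequence or tend to 0 locally uniformly; Montel's theorem applies in the
   former case, and F_k tends to infinity in the latter.
   All the complex analysis rests on the inequality |F c| <= max |F| over a circle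
   centred at c, obtained from Goursat's lemma on rectangles through the
   exponential map. *)

(** * Complex differentiability in Carathéodory's form *)

(** A bound on [g (F_k)] is no bound on [F_k], since [g] may stay bounded along unbounded sets; it
    only tells which places [F_k] avoids. This is why families omitting a disc have to be treated,
    and why [F_k] may tend to infinity even where [g (F_k)] has a finite limit. Normality asks only
    for locally uniform convergence to some function, so limits are never shown to be holomorphic.
    In place of Cauchy's formula, the inequality at the centre of a circle is applied to quotients
    made for the purpose: [1 / phi] for the minimum principle, powers of [F] over powers of a
    product of linear factors for Schwarz-type bounds. *)

Definition ccont (F : C -> C) (z : C) : Prop :=
  forall eps, 0 < eps -> exists d, 0 < d /\
    forall w, Cmod (w - z)%C < d -> Cmod (F w - F z)%C < eps.

(** With a quotient [Q] continuous at [z], the rules of calculus become algebraic identities, and at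
    a common zero of two functions the factors [w - z] can be cancelled outright. *)
Definition cdiff (F : C -> C) (z : C) : Prop :=
  exists Q : C -> C, ccont Q z /\ forall w, F w = (F z + Q w * (w - z))%C.

Lemma Cmod_sub_sym (a b : C) : Cmod (a - b)%C = Cmod (b - a)%C.
Proof.
  replace (a - b)%C with (- (b - a))%C by ring.
  apply Cmod_opp.
Qed.

Lemma Cmod_triangle_rev (a b : C) : Cmod a - Cmod b <= Cmod (a - b)%C.
Proof.
  pose proof (Cmod_triangle (a - b)%C b) as H.
  replace (a - b + b)%C with a in H by ring. lra.
Qed.

Lemma Cmod_triangle3 (a b c : C) :
  Cmod (a - c)%C <= Cmod (a - b)%C + Cmod (b - c)%C.
Proof.
  replace (a - c)%C with ((a - b) + (b - c))%C by ring.
  apply Cmod_triangle.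
Qed.

Lemma Cmod_sub_0 (z : C) : Cmod (z - z)%C = 0.
Proof.
  replace (z - z)%C with (RtoC 0) by ring. apply Cmod_0.
Qed.

Lemma Cmod_neq0 (z : C) : 0 < Cmod z -> z <> RtoC 0.
Proof. apply Cmod_gt_0. Qed.

Lemma ccont_const (c z : C) : ccont (fun _ => c) z.
Proof.
  intros eps He. exists 1. split; [lra|]. intros w _. now rewrite Cmod_sub_0.
Qed.

Lemma ccont_id (z : C) : ccont (fun w => w) z.
Proof. intros eps He. exists eps. auto. Qed.

Lemma ccont_ext (F G : C -> C) (z : C) :
  (forall w, F w = G w) -> ccont F z -> ccont G z.
Proof.
  intros H HF eps He. destruct (HF eps He) as [d [Hd K]].
  exists d. split; auto. intros w Hw. rewrite <- !H. auto.
Qed.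

Lemma ccont_plus (F G : C -> C) (z : C) :
  ccont F z -> ccont G z -> ccont (fun w => F w + G w)%C z.
Proof.
  intros HF HG eps He.
  destruct (HF (eps / 2)) as [d1 [Hd1 K1]]; [lra|].
  destruct (HG (eps / 2)) as [d2 [Hd2 K2]]; [lra|].
  exists (Rmin d1 d2). split; [now apply Rmin_pos|].
  intros w Hw.
  pose proof (Rmin_l d1 d2). pose proof (Rmin_r d1 d2).
  replace (F w + G w - (F z + G z))%C with ((F w - F z) + (G w - G z))%C by ring.
  eapply Rle_lt_trans; [apply Cmod_triangle|].
  specialize (K1 w). specialize (K2 w). lra.
Qed.

Lemma ccont_mult (F G : C -> C) (z : C) :
  ccont F z -> ccont G z -> ccont (fun w => F w * G w)%C z.
Proof.
  intros HF HG eps He.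
  pose proof (Cmod_ge_0 (F z)) as PF. pose proof (Cmod_ge_0 (G z)) as PG.
  set (e1 := eps / (2 * (Cmod (G z) + 1))).
  set (e2 := eps / (2 * (Cmod (F z) + 1))).
  assert (E1 : 0 < e1) by (apply Rdiv_lt_0_compat; lra).
  assert (E2 : 0 < e2) by (apply Rdiv_lt_0_compat; lra).
  destruct (HF e1 E1) as [d1 [Hd1 K1]].
  destruct (HG e2 E2) as [d2 [Hd2 K2]].
  destruct (HG 1 Rlt_0_1) as [d3 [Hd3 K3]].
  exists (Rmin d1 (Rmin d2 d3)).
  split; [now repeat apply Rmin_pos|].
  intros w Hw.
  pose proof (Rmin_l d1 (Rmin d2 d3)). pose proof (Rmin_r d1 (Rmin d2 d3)).
  pose proof (Rmin_l d2 d3). pose proof (Rmin_r d2 d3).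
  specialize (K1 w ltac:(lra)). specialize (K2 w ltac:(lra)).
  specialize (K3 w ltac:(lra)).
  replace (F w * G w - F z * G z)%C
    with ((F w - F z) * G w + F z * (G w - G z))%C by ring.
  eapply Rle_lt_trans; [apply Cmod_triangle|].
  rewrite !Cmod_mult.
  assert (B : Cmod (G w) <= Cmod (G z) + 1).
  { pose proof (Cmod_triangle_rev (G w) (G z)). lra. }
  assert (X1 : Cmod (F w - F z)%C * Cmod (G w) <= e1 * (Cmod (G z) + 1)).
  { apply Rmult_le_compat; auto using Cmod_ge_0; lra. }
  assert (X2 : Cmod (F z) * Cmod (G w - G z)%C <= Cmod (F z) * e2).
  { apply Rmult_le_compat_l; auto; lra. }
  assert (Y1 : e1 * (Cmod (G z) + 1) = eps / 2) by (unfold e1; field; lra).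
  assert (Y2 : (Cmod (F z) + 1) * e2 = eps / 2) by (unfold e2; field; lra).
  nra.
Qed.

Lemma ccont_opp (F : C -> C) (z : C) : ccont F z -> ccont (fun w => - F w)%C z.
Proof.
  intros HF. apply ccont_ext with (fun w => RtoC (-1) * F w)%C.
  - intros w. ring.
  - apply ccont_mult; [apply ccont_const | exact HF].
Qed.

Lemma ccont_minus (F G : C -> C) (z : C) :
  ccont F z -> ccont G z -> ccont (fun w => F w - G w)%C z.
Proof. intros HF HG. apply ccont_plus; [|apply ccont_opp]; auto. Qed.

Lemma ccont_comp (F G : C -> C) (z : C) :
  ccont G z -> ccont F (G z) -> ccont (fun w => F (G w)) z.
Proof.
  intros HG HF eps He. destruct (HF eps He) as [d [Hd K]].
  destruct (HG d Hd) as [d' [Hd' K']]. exists d'. auto.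
Qed.

Lemma ccont_neq0 (F : C -> C) (z : C) :
  ccont F z -> F z <> RtoC 0 ->
  exists d, 0 < d /\ forall w, Cmod (w - z)%C < d -> Cmod (F z) / 2 < Cmod (F w).
Proof.
  intros HF H0. apply Cmod_gt_0 in H0.
  destruct (HF (Cmod (F z) / 2)) as [d [Hd K]]; [lra|].
  exists d. split; auto. intros w Hw. specialize (K w Hw).
  rewrite Cmod_sub_sym in K. pose proof (Cmod_triangle_rev (F z) (F w)). lra.
Qed.

Lemma ccont_inv (F : C -> C) (z : C) :
  ccont F z -> F z <> RtoC 0 -> ccont (fun w => / F w)%C z.
Proof.
  intros HF H0 eps He.
  destruct (ccont_neq0 F z HF H0) as [d1 [Hd1 K1]].
  pose proof (proj1 (Cmod_gt_0 _) H0) as P.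
  set (m := Cmod (F z)) in *.
  destruct (HF (eps * (m / 2 * m))) as [d2 [Hd2 K2]].
  { repeat apply Rmult_lt_0_compat; lra. }
  exists (Rmin d1 d2). split; [now apply Rmin_pos|]. intros w Hw.
  pose proof (Rmin_l d1 d2). pose proof (Rmin_r d1 d2).
  specialize (K1 w ltac:(lra)). specialize (K2 w ltac:(lra)).
  assert (N : F w <> RtoC 0) by (apply Cmod_neq0; lra).
  replace (/ F w - / F z)%C with ((F z - F w) / (F w * F z))%C
    by (field; auto).
  rewrite Cmod_div, Cmod_mult by (apply Cmult_neq_0; auto).
  rewrite Cmod_sub_sym. fold m.
  apply Rmult_lt_reg_r with (Cmod (F w) * m); [nra|].
  unfold Rdiv. rewrite Rmult_assoc, Rinv_l by nra.
  rewrite Rmult_1_r. eapply Rlt_le_trans; [exact K2|].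
  apply Rmult_le_compat_l; [lra|]. apply Rmult_le_compat_r; lra.
Qed.

(** Away from [z] the plain difference quotient always serves, so a quotient has to be supplied only
    near [z]. *)
Lemma cdiff_local (F Q : C -> C) (z : C) (d : R) :
  0 < d -> ccont Q z ->
  (forall w, Cmod (w - z)%C < d -> F w = F z + Q w * (w - z))%C -> cdiff F z.
Proof.
  intros Hd HQ H.
  exists (fun w => if Rlt_dec (Cmod (w - z)%C) d then Q w
                   else (F w - F z) / (w - z))%C.
  split.
  - intros eps He. destruct (HQ eps He) as [d' [Hd' K]].
    exists (Rmin d d'). split; [now apply Rmin_pos|]. intros w Hw.
    pose proof (Rmin_l d d'). pose proof (Rmin_r d d').
    destruct (Rlt_dec (Cmod (w - z)%C) d); [|lra].
    destruct (Rlt_dec (Cmod (z - z)%C) d) as [_|n].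
    + apply K. lra.
    + rewrite Cmod_sub_0 in n. lra.
  - intros w. destruct (Rlt_dec (Cmod (w - z)%C) d) as [l|n]; auto.
    field. apply Cmod_neq0. lra.
Qed.

Lemma cdiff_ext_local (F G : C -> C) (z : C) (d : R) :
  0 < d -> (forall w, Cmod (w - z)%C < d -> F w = G w) -> cdiff F z -> cdiff G z.
Proof.
  intros Hd H [Q [HQ K]]. apply cdiff_local with Q d; auto.
  intros w Hw. rewrite <- !H; auto. now rewrite Cmod_sub_0.
Qed.

Lemma cdiff_ext (F G : C -> C) (z : C) :
  (forall w, F w = G w) -> cdiff F z -> cdiff G z.
Proof.
  intros H HF. apply cdiff_ext_local with F 1; auto; lra.
Qed.

Lemma cdiff_ccont (F : C -> C) (z : C) : cdiff F z -> ccont F z.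
Proof.
  intros [Q [HQ K]].
  apply ccont_ext with (fun w => F z + Q w * (w - z))%C.
  - intros w. now rewrite <- K.
  - apply ccont_plus; [apply ccont_const|].
    apply ccont_mult; auto. apply ccont_minus; [apply ccont_id|apply ccont_const].
Qed.

Lemma cdiff_const (c z : C) : cdiff (fun _ => c) z.
Proof.
  exists (fun _ => RtoC 0). split; [apply ccont_const|]. intros w. ring.
Qed.

Lemma cdiff_id (z : C) : cdiff (fun w => w) z.
Proof.
  exists (fun _ => RtoC 1). split; [apply ccont_const|]. intros w. ring.
Qed.

Lemma cdiff_plus (F G : C -> C) (z : C) :
  cdiff F z -> cdiff G z -> cdiff (fun w => F w + G w)%C z.
Proof.
  intros [Q [HQ K]] [S [HS L]]. exists (fun w => Q w + S w)%C.
  split; [now apply ccont_plus|]. intros w. rewrite (K w), (L w). ring.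
Qed.

Lemma cdiff_mult (F G : C -> C) (z : C) :
  cdiff F z -> cdiff G z -> cdiff (fun w => F w * G w)%C z.
Proof.
  intros HF HG. pose proof (cdiff_ccont G z HG) as CG.
  destruct HF as [Q [HQ K]]. destruct HG as [S [HS L]].
  exists (fun w => Q w * G w + F z * S w)%C. split.
  - apply ccont_plus; apply ccont_mult; auto. apply ccont_const.
  - intros w. rewrite (K w), (L w). ring.
Qed.

Lemma cdiff_minus (F G : C -> C) (z : C) :
  cdiff F z -> cdiff G z -> cdiff (fun w => F w - G w)%C z.
Proof.
  intros [Q [HQ K]] [S [HS L]]. exists (fun w => Q w - S w)%C.
  split; [now apply ccont_minus|]. intros w. rewrite (K w), (L w). ring.
Qed.

Lemma cdiff_comp (F G : C -> C) (z : C) :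
  cdiff G z -> cdiff F (G z) -> cdiff (fun w => F (G w)) z.
Proof.
  intros HG HF. pose proof (cdiff_ccont G z HG) as CG.
  destruct HF as [Q [HQ K]]. destruct HG as [S [HS L]].
  exists (fun w => Q (G w) * S w)%C. split.
  - apply ccont_mult; auto. now apply ccont_comp.
  - intros w. rewrite (K (G w)).
    replace (G w - G z)%C with (S w * (w - z))%C by (rewrite (L w); ring). ring.
Qed.

Lemma cdiff_inv (F : C -> C) (z : C) :
  cdiff F z -> F z <> RtoC 0 -> cdiff (fun w => / F w)%C z.
Proof.
  intros HF H0. pose proof (cdiff_ccont F z HF) as CF.
  destruct (ccont_neq0 F z CF H0) as [d [Hd N]].
  destruct HF as [Q [HQ K]].
  apply cdiff_local with (fun w => - Q w * (/ F w * / F z))%C d; auto.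
  - apply ccont_mult; [now apply ccont_opp|].
    apply ccont_mult; [now apply ccont_inv|apply ccont_const].
  - intros w Hw. specialize (N w Hw).
    pose proof (Cmod_ge_0 (F z)).
    assert (F w <> RtoC 0) by (apply Cmod_neq0; lra).
    replace (- Q w * (/ F w * / F z) * (w - z))%C
      with (- (Q w * (w - z)) * (/ F w * / F z))%C by ring.
    replace (Q w * (w - z))%C with (F w - F z)%C by (rewrite (K w); ring).
    field. auto.
Qed.

Lemma cdiff_pow (F : C -> C) (z : C) (n : nat) :
  cdiff F z -> cdiff (fun w => F w ^ n)%C z.
Proof.
  intros HF. induction n as [|n IH]; simpl.
  - apply cdiff_const.
  - now apply (cdiff_mult F (fun w => F w ^ n)%C).
Qed.

Lemma ccont_pow (F : C -> C) (z : C) (n : nat) :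
  ccont F z -> ccont (fun w => F w ^ n)%C z.
Proof.
  intros HF. induction n as [|n IH]; simpl.
  - apply ccont_const.
  - now apply (ccont_mult F (fun w => F w ^ n)%C).
Qed.

Lemma cdiff_of_approx (F : C -> C) (z l : C) :
  (forall eps, 0 < eps -> exists d, 0 < d /\ forall w, Cmod (w - z)%C < d ->
     Cmod (F w - F z - (w - z) * l)%C <= eps * Cmod (w - z)%C) ->
  cdiff F z.
Proof.
  intros Hl.
  exists (fun w => if excluded_middle_informative (w = z) then l
                   else (F w - F z) / (w - z))%C.
  assert (NZ : forall w, w <> z -> (w - z)%C <> RtoC 0).
  { intros w Hw E. apply Hw. replace w with ((w - z) + z)%C by ring.
    rewrite E. ring. }
  split.
  - intros eps He.
    destruct (Hl (eps / 2)) as [d [Hd K]]; [lra|].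
    exists d. split; auto. intros w Hw.
    destruct (excluded_middle_informative (z = z)) as [_|n]; [|now elim n].
    destruct (excluded_middle_informative (w = z)) as [_|n].
    + now rewrite Cmod_sub_0.
    + specialize (K w Hw).
      replace ((F w - F z) / (w - z) - l)%C
        with ((F w - F z - (w - z) * l) / (w - z))%C by (field; auto).
      rewrite Cmod_div by auto.
      pose proof (proj1 (Cmod_gt_0 _) (NZ w n)) as P.
      apply Rmult_lt_reg_r with (Cmod (w - z)%C); auto.
      unfold Rdiv. rewrite Rmult_assoc, Rinv_l, Rmult_1_r by lra. nra.
  - intros w. destruct (excluded_middle_informative (w = z)) as [->|n].
    + ring.
    + field. auto.
Qed.

Lemma entire_cdiff (f : C -> C) : entire f -> forall z, cdiff f z.
Proof.
  intros Hf z. destruct (Hf z) as [l [_ Hl]].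
  (* [locally z] converges to [z] trivially; what remains is the epsilon estimate of
     [cdiff_of_approx]. *)
  specialize (Hl z (fun P HP => HP)).
  apply cdiff_of_approx with l. intros eps He.
  destruct (Hl (mkposreal _ He)) as [[d Hd] K].
  exists d. split; auto.
Qed.
(** * Goursat's lemma on rectangles *)

Lemma nested_intervals (u v : nat -> R) :
  (forall n, u n <= u (S n)) -> (forall n, v (S n) <= v n) ->
  (forall n, u n <= v n) -> exists p, forall n, u n <= p <= v n.
Proof.
  intros Hu Hv Huv.
  assert (Mu : forall n k, u n <= u (n + k)%nat).
  { intros n k. induction k as [|k IH].
    - rewrite Nat.add_0_r. lra.
    - rewrite Nat.add_succ_r. specialize (Hu (n + k)%nat). lra. }
  assert (Mv : forall n k, v (n + k)%nat <= v n).
  { intros n k. induction k as [|k IH].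
    - rewrite Nat.add_0_r. lra.
    - rewrite Nat.add_succ_r. specialize (Hv (n + k)%nat). lra. }
  assert (UV : forall m n, u m <= v n).
  { intros m n. specialize (Mu m n). specialize (Mv n m).
    rewrite (Nat.add_comm n m) in Mv. specialize (Huv (m + n)%nat). lra. }
  destruct (completeness (fun x => exists n, x = u n)) as [p [P1 P2]].
  - exists (v 0%nat). intros x [n ->]. apply UV.
  - exists (u 0%nat). now exists 0%nat.
  - exists p. intros n. split.
    + apply P1. now exists n.
    + apply P2. intros x [m ->]. apply UV.
Qed.

Lemma half_pow_lt (c d : R) : 0 <= c -> 0 < d -> exists n, c * (/ 2) ^ n < d.
Proof.
  intros Hc Hd.
  destruct (pow_lt_1_zero (/ 2)) with (y := d / (c + 1)) as [N HN].
  - rewrite Rabs_pos_eq; lra.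
  - apply Rdiv_lt_0_compat; lra.
  - exists N. specialize (HN N (Nat.le_refl _)).
    assert (P : 0 < (/ 2) ^ N) by (apply pow_lt; lra).
    rewrite Rabs_pos_eq in HN by lra.
    apply Rmult_lt_compat_r with (r := c + 1) in HN; [|lra].
    unfold Rdiv in HN. rewrite Rmult_assoc, Rinv_l in HN by lra. nra.
Qed.

(** Goursat's bisection for an abstract additive [J]. Some quarter carries at least a quarter of
    [Rabs J], so [n] steps lose a factor [4 ^ n]; the half-perimeter shrinks by [2 ^ n], and the
    quadratic bound at the common point of the nested rectangles makes up for the loss. *)
Lemma additive_rectangle_null (J : R -> R -> R -> R -> R) (a b c d : R) :
  a <= b -> c <= d ->
  (forall x0 x1 y0 y1, a <= x0 -> x0 <= x1 -> x1 <= b ->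
     c <= y0 -> y0 <= y1 -> y1 <= d ->
     J x0 x1 y0 y1 =
       J x0 ((x0 + x1) / 2) y0 ((y0 + y1) / 2) + J ((x0 + x1) / 2) x1 y0 ((y0 + y1) / 2) +
       (J x0 ((x0 + x1) / 2) ((y0 + y1) / 2) y1 + J ((x0 + x1) / 2) x1 ((y0 + y1) / 2) y1)) ->
  (forall p q, a <= p <= b -> c <= q <= d -> forall eps, 0 < eps ->
     exists del, 0 < del /\ forall x0 x1 y0 y1,
       a <= x0 <= p -> p <= x1 <= b -> c <= y0 <= q -> q <= y1 <= d ->
       x1 - x0 + (y1 - y0) < del ->
       Rabs (J x0 x1 y0 y1) <= eps * (x1 - x0 + (y1 - y0)) ^ 2) ->
  J a b c d = 0.
Proof.
  intros Hab Hcd Hadd Hloc.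
  set (A := fun n => (b - a) * (/ 2) ^ n).
  set (B := fun n => (d - c) * (/ 2) ^ n).
  assert (PA : forall n, 0 <= A n).
  { intros n. apply Rmult_le_pos; [lra|]. apply pow_le; lra. }
  assert (PB : forall n, 0 <= B n).
  { intros n. apply Rmult_le_pos; [lra|]. apply pow_le; lra. }
  assert (SA : forall n, A (S n) = A n / 2) by (intros n; unfold A; simpl; field).
  assert (SB : forall n, B (S n) = B n / 2) by (intros n; unfold B; simpl; field).
  (* A rectangle of generation [n] has sides [A n] and [B n], so its lower left corner [s]
     determines it. *)
  set (K := fun n (s : R * R) => J (fst s) (fst s + A n) (snd s) (snd s + B n)).
  set (ok := fun n (s : R * R) =>
    (a <= fst s /\ fst s + A n <= b) /\ (c <= snd s /\ snd s + B n <= d)).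
  set (good := fun n (s t : R * R) =>
    ((fst s <= fst t /\ fst t + A (S n) <= fst s + A n) /\
     (snd s <= snd t /\ snd t + B (S n) <= snd s + B n)) /\
    Rabs (K n s) <= 4 * Rabs (K (S n) t)).
  (* The existential stands outside the implication so that choice gives a total function [next]. *)
  assert (Hstep : forall n s, exists t, ok n s -> good n s t).
  { intros n [x y]. apply NNPP. intros Hno.
    assert (Hok : ok n (x, y)).
    { apply NNPP. intros nok. apply Hno. exists (x, y). tauto. }
    assert (Bad : forall t, ~ good n (x, y) t).
    { intros t Ht. apply Hno. now exists t. }
    clear Hno. unfold ok, good, K in *. cbn [fst snd] in *.
    specialize (PA n). specialize (PB n). specialize (SA n). specialize (SB n).
    assert (X : J x (x + A n) y (y + B n) =
      J x (x + A (S n)) y (y + B (S n)) +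
      J (x + A (S n)) (x + A (S n) + A (S n)) y (y + B (S n)) +
      (J x (x + A (S n)) (y + B (S n)) (y + B (S n) + B (S n)) +
       J (x + A (S n)) (x + A (S n) + A (S n)) (y + B (S n)) (y + B (S n) + B (S n)))).
    { rewrite Hadd by lra.
      replace ((x + (x + A n)) / 2) with (x + A (S n)) by lra.
      replace ((y + (y + B n)) / 2) with (y + B (S n)) by lra.
      replace (x + A (S n) + A (S n)) with (x + A n) by lra.
      replace (y + B (S n) + B (S n)) with (y + B n) by lra.
      reflexivity. }
    pose proof (Bad (x, y)) as B1. pose proof (Bad (x + A (S n), y)) as B2.
    pose proof (Bad (x, y + B (S n))) as B3.
    pose proof (Bad (x + A (S n), y + B (S n))) as B4.
    cbn [fst snd] in *. clear Bad.
    (* If every quarter fell short of a quarter of [Rabs J], the four together would fall short of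
       the whole. *)
    apply B1. split; [lra|]. apply Rnot_lt_le. intros C1.
    apply B2. split; [lra|]. apply Rnot_lt_le. intros C2.
    apply B3. split; [lra|]. apply Rnot_lt_le. intros C3.
    apply B4. split; [lra|]. apply Rnot_lt_le. intros C4.
    rewrite X in C1, C2, C3, C4.
    match goal with H : _ < Rabs (?j1 + ?j2 + (?j3 + ?j4)) |- _ =>
      pose proof (Rabs_triang (j1 + j2) (j3 + j4));
      pose proof (Rabs_triang j1 j2); pose proof (Rabs_triang j3 j4) end.
    lra. }
  set (next := fun n s => proj1_sig (constructive_indefinite_description _ (Hstep n s))).
  assert (Hnext : forall n s, ok n s -> good n s (next n s)).
  { intros n s. unfold next.
    destruct (constructive_indefinite_description _ (Hstep n s)) as [t Ht]. auto. }
  set (s := fix s n := match n with O => (a, c) | S m => next m (s m) end).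
  assert (Hok : forall n, ok n (s n)).
  { induction n as [|n IH].
    - unfold ok, A, B; simpl. lra.
    - destruct (Hnext n (s n) IH) as [G _]. change (s (S n)) with (next n (s n)).
      unfold ok in *. lra. }
  assert (Hgood : forall n, good n (s n) (s (S n))) by (intros n; apply Hnext, Hok).
  assert (Hbig : forall n, Rabs (J a b c d) <= 4 ^ n * Rabs (K n (s n))).
  { induction n as [|n IH].
    - unfold K, A, B; simpl.
      replace (a + (b - a) * 1) with b by ring.
      replace (c + (d - c) * 1) with d by ring. lra.
    - destruct (Hgood n) as [_ G]. change (4 ^ S n) with (4 * 4 ^ n).
      assert (0 < 4 ^ n) by (apply pow_lt; lra). nra. }
  destruct (nested_intervals (fun n => fst (s n)) (fun n => fst (s n) + A n)) as [p Hp].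
  - intros n. apply (Hgood n).
  - intros n. apply (Hgood n).
  - intros n. specialize (PA n). lra.
  - destruct (nested_intervals (fun n => snd (s n)) (fun n => snd (s n) + B n)) as [q Hq].
    + intros n. apply (Hgood n).
    + intros n. apply (Hgood n).
    + intros n. specialize (PB n). lra.
    + assert (Small : forall eps, 0 < eps ->
        Rabs (J a b c d) <= eps * (b - a + (d - c)) ^ 2).
      { intros eps He.
        destruct (Hloc p q) with (eps := eps) as [del [Hdel H]]; auto.
        - pose proof (Hp 0%nat). pose proof (Hok 0%nat). unfold ok in *. lra.
        - pose proof (Hq 0%nat). pose proof (Hok 0%nat). unfold ok in *. lra.
        - destruct (half_pow_lt (b - a + (d - c)) del) as [n Hn]; [lra|lra|].
          eapply Rle_trans; [apply (Hbig n)|].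
          specialize (Hp n). specialize (Hq n). specialize (Hok n). unfold ok in Hok.
          assert (E : A n + B n = (b - a + (d - c)) * (/ 2) ^ n)
            by (unfold A, B; ring).
          unfold K.
          specialize (H (fst (s n)) (fst (s n) + A n) (snd (s n)) (snd (s n) + B n)).
          replace (fst (s n) + A n - fst (s n) + (snd (s n) + B n - snd (s n)))
            with (A n + B n) in H by ring.
          rewrite E in H.
          assert (Q : 4 ^ n * ((/ 2) ^ n) ^ 2 = 1).
          { rewrite <- pow_mult, Nat.mul_comm, pow_mult, <- Rpow_mult_distr.
            replace (4 * (/ 2) ^ 2) with 1 by field. apply pow1. }
          apply Rle_trans with
            (4 ^ n * (eps * ((b - a + (d - c)) * (/ 2) ^ n) ^ 2)).
          + apply Rmult_le_compat_l; [apply pow_le; lra|]. apply H; lra.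
          + rewrite Rpow_mult_distr.
            replace (4 ^ n * (eps * ((b - a + (d - c)) ^ 2 * ((/ 2) ^ n) ^ 2)))
              with (eps * (b - a + (d - c)) ^ 2 * (4 ^ n * ((/ 2) ^ n) ^ 2)) by ring.
            rewrite Q. lra. }
      apply NNPP. intros N. apply Rabs_pos_lt in N.
      set (D := (b - a + (d - c)) ^ 2) in *.
      assert (PD : 0 <= D) by apply pow2_ge_0.
      (* With [D + 1] instead of [D] the choice also covers a degenerate rectangle. *)
      specialize (Small (Rabs (J a b c d) / (2 * (D + 1)))).
      set (X := Rabs (J a b c d)) in *.
      assert (Y : 0 < X / (2 * (D + 1))) by (apply Rdiv_lt_0_compat; lra).
      specialize (Small Y).
      assert (Z : X / (2 * (D + 1)) * (D + 1) = X / 2) by (field; lra). nra.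
Qed.

(** * Integrals along the sides of a rectangle *)

Lemma continuous_along (G : C -> C) (gam : R -> C) (L : C -> R) (t : R) :
  (forall s, Cmod (gam s - gam t)%C <= Rabs (s - t)) ->
  (forall z w, Rabs (L z - L w) <= Cmod (z - w)%C) ->
  ccont G (gam t) -> continuous (fun s => L (G (gam s))) t.
Proof.
  intros Hg HL HG. apply filterlim_locally. intros [eps He]. simpl.
  destruct (HG eps He) as [d [Hd K]]. exists (mkposreal d Hd).
  intros s Hs. change (Rabs (s - t) < d) in Hs.
  change (Rabs (L (G (gam s)) - L (G (gam t))) < eps).
  eapply Rle_lt_trans; [apply HL|]. apply K. eapply Rle_lt_trans; [apply Hg|auto].
Qed.

Lemma Re_lip (z w : C) : Rabs (Re z - Re w) <= Cmod (z - w)%C.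
Proof. exact (re_le_Cmod (z - w)%C). Qed.

Lemma Im_lip (z w : C) : Rabs (Im z - Im w) <= Cmod (z - w)%C.
Proof.
  eapply Rle_trans; [|apply (Rmax_Cmod (z - w)%C)]. apply Rmax_r.
Qed.

Lemma hline_lip (y x s : R) : Cmod ((s, y) - (x, y) : C)%C <= Rabs (s - x).
Proof.
  replace ((s, y) - (x, y) : C)%C with (RtoC (s - x)).
  - rewrite Cmod_R. lra.
  - apply injective_projections; simpl; ring.
Qed.

Lemma Cmod_pair_le (x y : R) : Cmod (x, y) <= Rabs x + Rabs y.
Proof.
  replace (x, y) with (RtoC x + Ci * RtoC y)%C.
  - eapply Rle_trans; [apply Cmod_triangle|].
    rewrite Cmod_mult, !Cmod_R, Cmod_Ci. lra.
  - apply injective_projections; simpl; ring.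
Qed.

Lemma vline_lip (x y s : R) : Cmod ((x, s) - (x, y) : C)%C <= Rabs (s - y).
Proof.
  replace ((x, s) - (x, y) : C)%C with ((0, s - y) : C).
  - eapply Rle_trans; [apply Cmod_pair_le|]. rewrite Rabs_R0. lra.
  - apply injective_projections; simpl; ring.
Qed.

Lemma RInt_near_const (f : R -> R) (a b v e : R) :
  a <= b -> (forall x, a <= x <= b -> continuous f x) ->
  (forall x, a <= x <= b -> Rabs (f x - v) <= e) ->
  Rabs (RInt f a b - v * (b - a)) <= e * (b - a).
Proof.
  intros Hab Hc Hf.
  assert (E : ex_RInt f a b).
  { apply (ex_RInt_continuous (V := R_CompleteNormedModule)).
    intros z Hz. rewrite Rmin_left, Rmax_right in Hz by auto. auto. }
  assert (E' : ex_RInt (fun _ : R => v) a b) by apply ex_RInt_const.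
  assert (X : RInt (fun x => f x - v) a b = RInt f a b - v * (b - a)).
  { etransitivity.
    - exact (RInt_minus (V := R_CompleteNormedModule) f (fun _ => v) a b E E').
    - rewrite RInt_const. unfold minus, plus, opp, scal; simpl.
      unfold mult; simpl. ring. }
  rewrite <- X, Rmult_comm.
  apply abs_RInt_le_const; auto.
  apply (ex_RInt_minus (V := R_NormedModule)); auto.
Qed.

(** This is the imaginary part of the contour integral of [G dz] taken counterclockwise. It is the
    part in which the vertical sides contribute integrals of [Re G], which become circular means
    after composition with the exponential. *)
Definition rect_int (G : C -> C) (x0 x1 y0 y1 : R) : R :=
  RInt (fun x => Im (G (x, y0)) - Im (G (x, y1))) x0 x1 +
  RInt (fun y => Re (G (x1, y)) - Re (G (x0, y))) y0 y1.

Lemma continuous_hdiff (G : C -> C) (x y0 y1 : R) :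
  ccont G (x, y0) -> ccont G (x, y1) ->
  continuous (fun t => Im (G (t, y0)) - Im (G (t, y1))) x.
Proof.
  intros H0 H1. apply (continuous_minus (V := R_NormedModule)).
  - apply (continuous_along G (fun t => (t, y0)) Im); auto using hline_lip, Im_lip.
  - apply (continuous_along G (fun t => (t, y1)) Im); auto using hline_lip, Im_lip.
Qed.

Lemma continuous_vdiff (G : C -> C) (x0 x1 y : R) :
  ccont G (x0, y) -> ccont G (x1, y) ->
  continuous (fun t => Re (G (x1, t)) - Re (G (x0, t))) y.
Proof.
  intros H0 H1. apply (continuous_minus (V := R_NormedModule)).
  - apply (continuous_along G (fun t => (x1, t)) Re); auto using vline_lip, Re_lip.
  - apply (continuous_along G (fun t => (x0, t)) Re); auto using vline_lip, Re_lip.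
Qed.

Lemma RInt_split (f : R -> R) (a m b : R) :
  a <= m <= b -> (forall x, a <= x <= b -> continuous f x) ->
  RInt f a b = RInt f a m + RInt f m b.
Proof.
  intros Hm Hc. symmetry.
  apply (RInt_Chasles (V := R_CompleteNormedModule)).
  - apply (ex_RInt_continuous (V := R_CompleteNormedModule)).
    intros z Hz. rewrite Rmin_left, Rmax_right in Hz by lra. apply Hc. lra.
  - apply (ex_RInt_continuous (V := R_CompleteNormedModule)).
    intros z Hz. rewrite Rmin_left, Rmax_right in Hz by lra. apply Hc. lra.
Qed.

Lemma RInt_add (f g h : R -> R) (a b : R) :
  a <= b -> (forall x, a <= x <= b -> continuous f x) ->
  (forall x, a <= x <= b -> continuous g x) ->
  (forall x, h x = f x + g x) ->
  RInt h a b = RInt f a b + RInt g a b.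
Proof.
  intros Hab Hf Hg Hh.
  rewrite (RInt_ext h (fun x => plus (f x) (g x))) by (intros; apply Hh).
  apply (RInt_plus (V := R_CompleteNormedModule)).
  - apply (ex_RInt_continuous (V := R_CompleteNormedModule)).
    intros z Hz. rewrite Rmin_left, Rmax_right in Hz by lra. auto.
  - apply (ex_RInt_continuous (V := R_CompleteNormedModule)).
    intros z Hz. rewrite Rmin_left, Rmax_right in Hz by lra. auto.
Qed.

(** The horizontal integrals split at [m], and the new vertical side enters the two halves with
    opposite signs. *)
Lemma rect_int_split_x (G : C -> C) (x0 m x1 y0 y1 : R) :
  x0 <= m <= x1 -> y0 <= y1 ->
  (forall x y, x0 <= x <= x1 -> y0 <= y <= y1 -> ccont G (x, y)) ->
  rect_int G x0 x1 y0 y1 = rect_int G x0 m y0 y1 + rect_int G m x1 y0 y1.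
Proof.
  intros Hm Hy HG. unfold rect_int.
  rewrite (RInt_split (fun x => Im (G (x, y0)) - Im (G (x, y1))) x0 m x1); auto.
  2:{ intros x Hx. apply continuous_hdiff; apply HG; lra. }
  rewrite (RInt_add (fun y => Re (G (m, y)) - Re (G (x0, y)))
             (fun y => Re (G (x1, y)) - Re (G (m, y)))
             (fun y => Re (G (x1, y)) - Re (G (x0, y))) y0 y1); auto.
  - ring.
  - intros y Hy'. apply continuous_vdiff; apply HG; lra.
  - intros y Hy'. apply continuous_vdiff; apply HG; lra.
  - intros y. ring.
Qed.

Lemma rect_int_split_y (G : C -> C) (x0 x1 y0 n y1 : R) :
  x0 <= x1 -> y0 <= n <= y1 ->
  (forall x y, x0 <= x <= x1 -> y0 <= y <= y1 -> ccont G (x, y)) ->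
  rect_int G x0 x1 y0 y1 = rect_int G x0 x1 y0 n + rect_int G x0 x1 n y1.
Proof.
  intros Hx Hn HG. unfold rect_int.
  rewrite (RInt_split (fun y => Re (G (x1, y)) - Re (G (x0, y))) y0 n y1); auto.
  2:{ intros y Hy. apply continuous_vdiff; apply HG; lra. }
  rewrite (RInt_add (fun x => Im (G (x, y0)) - Im (G (x, n)))
             (fun x => Im (G (x, n)) - Im (G (x, y1)))
             (fun x => Im (G (x, y0)) - Im (G (x, y1))) x0 x1); auto.
  - ring.
  - intros x Hx'. apply continuous_hdiff; apply HG; lra.
  - intros x Hx'. apply continuous_hdiff; apply HG; lra.
  - intros x. ring.
Qed.

Lemma goursat (G : C -> C) (a b c d : R) :
  a <= b -> c <= d ->
  (forall x y, a <= x <= b -> c <= y <= d -> cdiff G (x, y)) ->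
  rect_int G a b c d = 0.
Proof.
  intros Hab Hcd HG.
  assert (HC : forall x y, a <= x <= b -> c <= y <= d -> ccont G (x, y)).
  { intros x y Hx Hy. apply cdiff_ccont. auto. }
  apply (additive_rectangle_null (rect_int G)); auto.
  - intros x0 x1 y0 y1 H1 H2 H3 H4 H5 H6.
    rewrite (rect_int_split_y G x0 x1 y0 ((y0 + y1) / 2) y1); try lra.
    2:{ intros x y Hx Hy. apply HC; lra. }
    rewrite (rect_int_split_x G x0 ((x0 + x1) / 2) x1 y0 ((y0 + y1) / 2)); try lra.
    2:{ intros x y Hx Hy. apply HC; lra. }
    rewrite (rect_int_split_x G x0 ((x0 + x1) / 2) x1 ((y0 + y1) / 2) y1); try lra.
    intros x y Hx Hy. apply HC; lra.
  - intros p q Hp Hq eps He.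
    destruct (HG p q Hp Hq) as [Q [HQ K]].
    destruct (HQ (eps / 2)) as [del [Hdel HQ']]; [lra|].
    exists del. split; auto.
    intros x0 x1 y0 y1 X0 X1 Y0 Y1 Hd.
    set (D := x1 - x0 + (y1 - y0)) in *.
    set (al := Re (Q (p, q))). set (be := Im (Q (p, q))).
    assert (Near : forall x y, x0 <= x <= x1 -> y0 <= y <= y1 ->
      exists e : C, Cmod e <= eps / 2 * D /\
        G (x, y) = (G (p, q) + Q (p, q) * ((x, y) - (p, q) : C) + e)%C).
    { intros x y Hx Hy.
      exists ((Q (x, y) - Q (p, q)) * ((x, y) - (p, q) : C))%C.
      assert (S : Cmod ((x, y) - (p, q) : C)%C <= D).
      { replace ((x, y) - (p, q) : C)%C with ((x - p, y - q) : C)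
          by (apply injective_projections; simpl; ring).
        eapply Rle_trans; [apply Cmod_pair_le|].
        assert (Rabs (x - p) <= x1 - x0) by (apply Rabs_le; lra).
        assert (Rabs (y - q) <= y1 - y0) by (apply Rabs_le; lra).
        unfold D. lra. }
      split.
      - rewrite Cmod_mult. apply Rmult_le_compat; auto using Cmod_ge_0.
        apply Rlt_le, HQ'. lra.
      - rewrite (K (x, y)). ring. }
    assert (ReN : forall x y, x0 <= x <= x1 -> y0 <= y <= y1 ->
      Rabs (Re (G (x, y)) - (Re (G (p, q)) + (al * (x - p) - be * (y - q))))
        <= eps / 2 * D).
    { intros x y Hx Hy. destruct (Near x y Hx Hy) as [e [E1 E2]].
      eapply Rle_trans; [|exact E1]. eapply Rle_trans; [|apply re_le_Cmod].
      right. f_equal. rewrite E2. unfold al, be, Re, Im. simpl. ring. }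
    assert (ImN : forall x y, x0 <= x <= x1 -> y0 <= y <= y1 ->
      Rabs (Im (G (x, y)) - (Im (G (p, q)) + (be * (x - p) + al * (y - q))))
        <= eps / 2 * D).
    { intros x y Hx Hy. destruct (Near x y Hx Hy) as [e [E1 E2]].
      eapply Rle_trans; [|exact E1].
      eapply Rle_trans; [|eapply Rle_trans; [apply Rmax_r|apply Rmax_Cmod]].
      right. f_equal. rewrite E2. unfold al, be, Re, Im. simpl. ring. }
    (* For the affine approximation of [G] the two integrands are the constants [al * (y0 - y1)] and
       [al * (x1 - x0)], whose integrals cancel. Each integrand is a difference of two values, which
       doubles the error [eps / 2 * D]. *)
    assert (I1 := RInt_near_const (fun x => Im (G (x, y0)) - Im (G (x, y1)))
                    x0 x1 (al * (y0 - y1)) (eps * D)).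
    assert (I2 := RInt_near_const (fun y => Re (G (x1, y)) - Re (G (x0, y)))
                    y0 y1 (al * (x1 - x0)) (eps * D)).
    unfold rect_int.
    set (r1 := RInt _ x0 x1) in *. set (r2 := RInt _ y0 y1) in *.
    assert (B1 : Rabs (r1 - al * (y0 - y1) * (x1 - x0)) <= eps * D * (x1 - x0)).
    { apply I1; [lra| |].
      - intros x Hx. apply continuous_hdiff; apply HC; lra.
      - intros x Hx. pose proof (ImN x y0 Hx ltac:(lra)) as N0.
        pose proof (ImN x y1 Hx ltac:(lra)) as N1.
        apply Rabs_le. apply Rabs_le_between in N0. apply Rabs_le_between in N1. lra. }
    assert (B2 : Rabs (r2 - al * (x1 - x0) * (y1 - y0)) <= eps * D * (y1 - y0)).
    { apply I2; [lra| |].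
      - intros y Hy. apply continuous_vdiff; apply HC; lra.
      - intros y Hy. pose proof (ReN x0 y ltac:(lra) Hy) as N0.
        pose proof (ReN x1 y ltac:(lra) Hy) as N1.
        apply Rabs_le. apply Rabs_le_between in N0. apply Rabs_le_between in N1. lra. }
    replace (eps * D ^ 2) with (eps * D * (x1 - x0) + eps * D * (y1 - y0))
      by (unfold D; ring).
    apply Rabs_le. apply Rabs_le_between in B1. apply Rabs_le_between in B2. nra.
Qed.

(** * The maximum modulus inequality at the centre of a disc *)

Definition cexp (z : C) : C := (exp (Re z) * cos (Im z), exp (Re z) * sin (Im z)).

Lemma cexp_plus (z w : C) : cexp (z + w)%C = (cexp z * cexp w)%C.
Proof.
  unfold cexp. change (Re (z + w)%C) with (Re z + Re w).
  change (Im (z + w)%C) with (Im z + Im w).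
  rewrite exp_plus, cos_plus, sin_plus.
  apply injective_projections; simpl; ring.
Qed.

Lemma Cmod_cexp (z : C) : Cmod (cexp z) = exp (Re z).
Proof.
  unfold Cmod, cexp. cbn [fst snd].
  replace (_ + _) with (exp (Re z) ^ 2 * (Rsqr (sin (Im z)) + Rsqr (cos (Im z))))
    by (unfold Rsqr; ring).
  rewrite sin2_cos2, Rmult_1_r. apply sqrt_pow2. apply Rlt_le, exp_pos.
Qed.

Lemma derivable_at_0_approx (f : R -> R) (l : R) :
  derivable_pt_lim f 0 l -> forall eps, 0 < eps -> exists d, 0 < d /\
    forall x, Rabs x < d -> Rabs (f x - f 0 - l * x) <= eps * Rabs x.
Proof.
  intros H eps He. destruct (H eps He) as [[d Hd] K]. exists d. split; auto.
  intros x Hx. destruct (Req_dec x 0) as [->|n].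
  - rewrite Rmult_0_r, !Rminus_0_r, Rminus_diag, Rabs_R0. lra.
  - specialize (K x n Hx). rewrite Rplus_0_l in K.
    replace (f x - f 0 - l * x) with (((f x - f 0) / x - l) * x) by (field; auto).
    rewrite Rabs_mult. apply Rmult_le_compat_r; [apply Rabs_pos|lra].
Qed.

Lemma cdiff_cexp_0 : cdiff cexp 0.
Proof.
  apply cdiff_of_approx with (RtoC 1). intros eps He.
  (* The error terms add up to at most [9 * (eps / 16) * r]; the estimate with constant 1 serves
     only to get [exp x <= 3]. *)
  assert (He16 : 0 < eps / 16) by lra.
  destruct (derivable_at_0_approx exp (exp 0) (derivable_pt_lim_exp 0) 1 Rlt_0_1)
    as [d0 [Hd0 K0]].
  destruct (derivable_at_0_approx exp (exp 0) (derivable_pt_lim_exp 0) (eps / 16) He16)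
    as [d1 [Hd1 K1]].
  destruct (derivable_at_0_approx cos (- sin 0) (derivable_pt_lim_cos 0) (eps / 16) He16)
    as [d2 [Hd2 K2]].
  destruct (derivable_at_0_approx sin (cos 0) (derivable_pt_lim_sin 0) (eps / 16) He16)
    as [d3 [Hd3 K3]].
  rewrite exp_0 in K0, K1. rewrite cos_0, sin_0 in K2, K3.
  exists (Rmin (Rmin 1 (eps / 16)) (Rmin d0 (Rmin d1 (Rmin d2 d3)))). split.
  { repeat apply Rmin_pos; lra. }
  intros [x y] Hw.
  replace ((x, y) - 0)%C with ((x, y) : C) in * by (apply injective_projections; simpl; ring).
  set (r := Cmod (x, y)) in *.
  pose proof (Rmin_l (Rmin 1 (eps / 16)) (Rmin d0 (Rmin d1 (Rmin d2 d3)))).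
  pose proof (Rmin_r (Rmin 1 (eps / 16)) (Rmin d0 (Rmin d1 (Rmin d2 d3)))).
  pose proof (Rmin_l 1 (eps / 16)). pose proof (Rmin_r 1 (eps / 16)).
  pose proof (Rmin_l d0 (Rmin d1 (Rmin d2 d3))).
  pose proof (Rmin_r d0 (Rmin d1 (Rmin d2 d3))).
  pose proof (Rmin_l d1 (Rmin d2 d3)). pose proof (Rmin_r d1 (Rmin d2 d3)).
  pose proof (Rmin_l d2 d3). pose proof (Rmin_r d2 d3).
  assert (X : Rabs x <= r) by apply (re_le_Cmod (x, y)).
  assert (Y : Rabs y <= r).
  { eapply Rle_trans; [apply Rmax_r|apply (Rmax_Cmod (x, y))]. }
  specialize (K0 x ltac:(lra)). specialize (K1 x ltac:(lra)).
  specialize (K2 y ltac:(lra)). specialize (K3 y ltac:(lra)).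
  unfold cexp. simpl Re. simpl Im. rewrite exp_0, cos_0, sin_0.
  replace (_ - _ - _)%C
    with ((exp x * cos y - 1 - x, exp x * sin y - y) : C)
    by (apply injective_projections; simpl; ring).
  eapply Rle_trans; [apply Cmod_pair_le|].
  rewrite ?Rmult_1_l in *.
  assert (E3 : 0 < exp x <= 3).
  { split; [apply exp_pos|]. pose proof (proj1 (Rabs_le_between _ _) K0).
    pose proof (proj1 (Rabs_le_between _ _) X). lra. }
  assert (Z1 : Rabs (exp x - 1) <= 2 * (eps / 16)).
  { replace (exp x - 1) with ((exp x - 1 - x) + x) by ring.
    eapply Rle_trans; [apply Rabs_triang|]. lra. }
  replace (exp x * cos y - 1 - x)
    with ((exp x - 1 - x) + exp x * (cos y - 1 - - 0 * y)) by ring.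
  replace (exp x * sin y - y)
    with (exp x * (sin y - 0 - y) + (exp x - 1) * y) by ring.
  pose proof (Rabs_triang (exp x - 1 - x) (exp x * (cos y - 1 - - 0 * y))) as T1.
  pose proof (Rabs_triang (exp x * (sin y - 0 - y)) ((exp x - 1) * y)) as T2.
  rewrite !Rabs_mult, (Rabs_pos_eq (exp x)) in T1, T2 by lra.
  pose proof (Rabs_pos (cos y - 1 - - 0 * y)). pose proof (Rabs_pos (sin y - 0 - y)).
  pose proof (Rabs_pos y). pose proof (Rabs_pos x). pose proof (Rabs_pos (exp x - 1)).
  assert (M1 : exp x * Rabs (cos y - 1 - - 0 * y) <= 3 * (eps / 16 * Rabs y))
    by (apply Rmult_le_compat; lra).
  assert (M2 : exp x * Rabs (sin y - 0 - y) <= 3 * (eps / 16 * Rabs y))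
    by (apply Rmult_le_compat; lra).
  assert (M3 : Rabs (exp x - 1) * Rabs y <= 2 * (eps / 16) * Rabs y)
    by (apply Rmult_le_compat_r; lra).
  assert (M4 : eps / 16 * Rabs y <= eps / 16 * r) by (apply Rmult_le_compat_l; lra).
  assert (M5 : eps / 16 * Rabs x <= eps / 16 * r) by (apply Rmult_le_compat_l; lra).
  rewrite (Rabs_mult (exp x - 1)) in T2.
  assert (M6 : 0 <= eps / 16 * r) by (apply Rmult_le_pos; lra).
  lra.
Qed.

(** The functional equation carries the derivative at the origin to every point. *)
Lemma cdiff_cexp (z : C) : cdiff cexp z.
Proof.
  apply cdiff_ext with (fun w => cexp z * cexp (w - z))%C.
  - intros w. rewrite <- cexp_plus. f_equal. ring.
  - apply (cdiff_mult (fun _ => cexp z) (fun w => cexp (w - z)%C)).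
    + apply cdiff_const.
    + apply (cdiff_comp cexp (fun w => w - z)%C).
      * apply cdiff_minus; [apply cdiff_id|apply cdiff_const].
      * replace (z - z)%C with (RtoC 0) by ring. apply cdiff_cexp_0.
Qed.

(* Goursat for [F] composed with [cexp] on [s, 0] x [0, 2 PI]: the horizontal
   sides cancel by periodicity, so the mean of [Re F] over the circle of radius
   [exp s] does not depend on [s]; let [s] tend to minus infinity. *)
Lemma Re_center_le (F : C -> C) (M : R) :
  (forall z, Cmod z <= 1 -> cdiff F z) ->
  (forall z, Cmod z = 1 -> Re (F z) <= M) -> Re (F 0) <= M.
Proof.
  intros HF HM. apply Rnot_lt_le. intros Hlt.
  set (e := (Re (F 0) - M) / 2).
  assert (He : 0 < e) by (unfold e; lra).
  destruct (cdiff_ccont F 0 (HF 0 ltac:(rewrite Cmod_0; lra)) e He) as [d [Hd K]].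
  (* One small circle replaces the limit: on radius [r] the values of [Re F] exceed [M + e], on
     radius 1 they are at most [M], so the two means cannot agree. *)
  set (r := Rmin d 1 / 2).
  assert (Hr : 0 < r) by (unfold r; pose proof (Rmin_pos d 1 Hd Rlt_0_1); lra).
  assert (Hrd : r < d) by (unfold r; pose proof (Rmin_l d 1); lra).
  assert (Hr1 : r < 1) by (unfold r in *; pose proof (Rmin_r d 1); lra).
  set (s := ln r).
  assert (Es : exp s = r) by (apply exp_ln; auto).
  assert (Hs : s < 0).
  { apply exp_lt_inv. rewrite Es, exp_0. auto. }
  set (G := fun z => F (cexp z)).
  pose proof PI_RGT_0 as HPI.
  assert (HG : forall x y, x <= 0 -> cdiff G (x, y)).
  { intros x y Hx. apply (cdiff_comp F cexp); [apply cdiff_cexp|].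
    apply HF. rewrite Cmod_cexp. simpl. rewrite <- exp_0.
    destruct (Rle_lt_or_eq_dec _ _ Hx) as [h| ->]; [|lra].
    now apply Rlt_le, exp_increasing. }
  assert (I0 : rect_int G s 0 0 (2 * PI) = 0).
  { apply goursat; try lra. intros x y Hx _. apply HG. lra. }
  unfold rect_int in I0.
  rewrite (RInt_ext _ (fun _ => 0)) in I0.
  2:{ intros x _. unfold G, cexp. simpl. rewrite cos_0, sin_0, cos_2PI, sin_2PI. ring. }
  rewrite RInt_const in I0. unfold scal in I0; simpl in I0. unfold mult in I0; simpl in I0.
  assert (I1 : RInt (fun y => Re (G (0, y)) - Re (G (s, y))) 0 (2 * PI)
               <= RInt (fun _ => - e) 0 (2 * PI)).
  { apply RInt_le; [lra| | |].
    - apply (ex_RInt_continuous (V := R_CompleteNormedModule)). intros y _.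
      apply continuous_vdiff; apply cdiff_ccont, HG; lra.
    - apply ex_RInt_const.
    - intros y _.
      assert (A1 : Re (G (0, y)) <= M).
      { apply HM. rewrite Cmod_cexp. simpl. apply exp_0. }
      assert (A2 : Cmod (G (s, y) - F 0)%C < e).
      { apply K. replace (cexp (s, y) - 0)%C with (cexp (s, y)) by ring.
        rewrite Cmod_cexp. simpl. lra. }
      pose proof (Re_lip (G (s, y)) (F 0)) as A3.
      apply Rabs_le_between in A3. unfold e in *. lra. }
  rewrite RInt_const in I1. unfold scal in I1; simpl in I1. unfold mult in I1; simpl in I1.
  nra.
Qed.

(** Multiplication by the unimodular number [la] turns [F c] into its modulus, so the inequality for
    real parts, rescaled to the unit disc, becomes one for moduli. *)
Lemma center_max (F : C -> C) (c : C) (R0 M : R) :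
  0 < R0 -> (forall z, Cmod (z - c)%C <= R0 -> cdiff F z) ->
  (forall z, Cmod (z - c)%C = R0 -> Cmod (F z) <= M) -> Cmod (F c) <= M.
Proof.
  intros HR HF HM.
  destruct (classic (F c = 0)) as [E|N].
  - rewrite E, Cmod_0. apply Rle_trans with (Cmod (F (c + R0)%C)).
    + apply Cmod_ge_0.
    + apply HM. replace (c + R0 - c)%C with (RtoC R0) by ring.
      rewrite Cmod_R. apply Rabs_pos_eq. lra.
  - pose proof (proj1 (Cmod_gt_0 _) N) as P.
    set (la := (Cconj (F c) / RtoC (Cmod (F c)))%C).
    assert (PN : RtoC (Cmod (F c)) <> RtoC 0).
    { intros E. apply RtoC_inj in E. lra. }
    assert (La : Cmod la = 1).
    { unfold la. rewrite Cmod_div, Cmod_conj, Cmod_R by auto.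
      rewrite Rabs_pos_eq by lra. field. lra. }
    assert (Lc : (la * F c)%C = RtoC (Cmod (F c))).
    { unfold la. replace (Cconj (F c) / Cmod (F c) * F c)%C
        with ((F c * Cconj (F c)) / Cmod (F c))%C by (field; auto).
      rewrite <- Cmod2_conj. rewrite RtoC_pow. field. auto. }
    assert (X := Re_center_le (fun z => la * F (c + R0 * z))%C M).
    cbv beta in X. replace (c + R0 * 0)%C with c in X by ring.
    rewrite Lc in X. apply X.
    + intros z Hz. apply (cdiff_mult (fun _ => la) (fun z => F (c + R0 * z)%C)).
      * apply cdiff_const.
      * apply (cdiff_comp F (fun z => c + R0 * z)%C).
        -- apply cdiff_plus; [apply cdiff_const|].
           apply (cdiff_mult (fun _ => RtoC R0)); [apply cdiff_const|apply cdiff_id].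
        -- apply HF. replace (c + R0 * z - c)%C with (R0 * z)%C by ring.
           rewrite Cmod_mult, Cmod_R, Rabs_pos_eq by lra. nra.
    + intros z Hz. eapply Rle_trans; [apply Rle_abs|].
      eapply Rle_trans; [apply re_le_Cmod|].
      rewrite Cmod_mult, La, Rmult_1_l. apply HM.
      replace (c + R0 * z - c)%C with (R0 * z)%C by ring.
      rewrite Cmod_mult, Cmod_R, Hz, Rabs_pos_eq by lra. ring.
Qed.

(** * Consequences of the maximum modulus inequality *)

Fixpoint zprod (l : list C) (z : C) : C :=
  match l with nil => RtoC 1 | a :: l' => ((z - a) * zprod l' z)%C end.

Lemma Csub_neq_0 (z a : C) : z <> a -> (z - a)%C <> RtoC 0.
Proof.
  intros H E. apply H. replace z with ((z - a) + a)%C by ring. rewrite E. ring.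
Qed.

Lemma zprod_neq_0 (l : list C) (z : C) : ~ In z l -> zprod l z <> RtoC 0.
Proof.
  induction l as [|a l IH]; simpl; intros H.
  - apply Cmod_neq0. rewrite Cmod_1. lra.
  - apply Cmult_neq_0; [apply Csub_neq_0|]; intuition.
Qed.

Lemma cdiff_zprod (l : list C) (z : C) : cdiff (zprod l) z.
Proof.
  induction l as [|a l IH]; simpl.
  - apply cdiff_const.
  - apply (cdiff_mult (fun w => w - a)%C (zprod l)); auto.
    apply cdiff_minus; [apply cdiff_id|apply cdiff_const].
Qed.

(** Without repetitions in [l] every zero is simple, so the cofactor [p] does not vanish at [a] and
    can be divided by near it. *)
Lemma zprod_factor (l : list C) (a : C) :
  NoDup l -> In a l -> exists p : C -> C,
    (forall z, zprod l z = ((z - a) * p z)%C) /\ (forall z, ccont p z) /\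
    p a <> RtoC 0.
Proof.
  induction l as [|b l IH]; intros ND Ha; [easy|].
  inversion ND as [|b' l' Nb ND']; subst. destruct Ha as [->|Ha].
  - exists (zprod l). split; [reflexivity|]. split.
    + intros z. apply cdiff_ccont, cdiff_zprod.
    + now apply zprod_neq_0.
  - destruct (IH ND' Ha) as [p [H1 [H2 H3]]].
    exists (fun z => (z - b) * p z)%C. split; [|split].
    + intros z. simpl. rewrite H1. ring.
    + intros z. apply (ccont_mult (fun z => z - b)%C); auto.
      apply ccont_minus; [apply ccont_id|apply ccont_const].
    + apply Cmult_neq_0; auto. apply Csub_neq_0. intros ->. contradiction.
Qed.

Lemma zprod_le (l : list C) (z : C) (t : R) :
  (forall a, In a l -> Cmod (z - a)%C <= t) -> Cmod (zprod l z) <= t ^ length l.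
Proof.
  induction l as [|a l IH]; simpl; intros H.
  - rewrite Cmod_1. lra.
  - rewrite Cmod_mult. apply Rmult_le_compat; auto using Cmod_ge_0.
Qed.

Lemma zprod_ge (l : list C) (z : C) (t : R) :
  0 <= t -> (forall a, In a l -> t <= Cmod (z - a)%C) ->
  t ^ length l <= Cmod (zprod l z).
Proof.
  intros Ht. induction l as [|a l IH]; simpl; intros H.
  - rewrite Cmod_1. lra.
  - rewrite Cmod_mult. apply Rmult_le_compat; auto using pow_le.
Qed.

(** Constant factors disappear under [n]-th roots: if [y < x], then [(y / x) ^ n] tends to 0. *)
Lemma le_of_pow_le (x y a b : R) :
  0 < a -> 0 <= x -> 0 <= y -> (forall n, x ^ n * a <= y ^ n * b) -> x <= y.
Proof.
  intros Ha Hx Hy H. apply Rnot_lt_le. intros L.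
  set (t := y / x).
  assert (T : 0 <= t < 1).
  { unfold t. split; [apply Rdiv_le_0_compat; lra|].
    apply Rmult_lt_reg_r with x; [lra|]. unfold Rdiv.
    rewrite Rmult_assoc, Rinv_l by lra. lra. }
  destruct (pow_lt_1_zero t) with (y := a / (Rabs b + 1)) as [n Hn].
  - rewrite Rabs_pos_eq; lra.
  - apply Rdiv_lt_0_compat; auto. pose proof (Rabs_pos b). lra.
  - specialize (Hn n (Nat.le_refl _)). specialize (H n).
    assert (P : 0 <= t ^ n) by (apply pow_le; lra).
    rewrite Rabs_pos_eq in Hn by auto.
    pose proof (Rabs_pos b) as PB. pose proof (Rle_abs b).
    assert (Q : t ^ n * (Rabs b + 1) < a).
    { apply Rmult_lt_compat_r with (r := Rabs b + 1) in Hn; [|lra].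
      unfold Rdiv in Hn. rewrite Rmult_assoc, Rinv_l in Hn by lra. lra. }
    assert (X : 0 < x ^ n) by (apply pow_lt; lra).
    assert (E : y ^ n = x ^ n * t ^ n).
    { rewrite <- Rpow_mult_distr. f_equal. unfold t. field. lra. }
    rewrite E, Rmult_assoc in H. apply Rmult_le_reg_l in H; auto. nra.
Qed.

(* Dividing [F] itself by the product would require removing singularities;
   [F ^ (n + 1) / zprod l ^ n] is differentiable at the zeros, and letting [n]
   tend to infinity gives the same bound. *)
Lemma bound_by_zeros (F : C -> C) (l : list C) (c : C) (R0 M m : R) :
  0 < R0 -> NoDup l ->
  (forall z, Cmod (z - c)%C <= R0 -> cdiff F z) ->
  (forall a, In a l -> F a = 0) ->
  (forall z, Cmod (z - c)%C = R0 -> Cmod (F z) <= M) ->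
  0 < m -> (forall z, Cmod (z - c)%C = R0 -> m <= Cmod (zprod l z)) ->
  Cmod (F c) * m <= M * Cmod (zprod l c).
Proof.
  intros HR ND HF HZ HM Hm Hp.
  assert (PM : 0 <= M).
  { apply Rle_trans with (Cmod (F (c + R0)%C)); [apply Cmod_ge_0|].
    apply HM. replace (c + R0 - c)%C with (RtoC R0) by ring.
    rewrite Cmod_R. apply Rabs_pos_eq. lra. }
  pose proof (Cmod_ge_0 (zprod l c)) as PP.
  destruct (classic (F c = 0)) as [E|N].
  { rewrite E, Cmod_0, Rmult_0_l. now apply Rmult_le_pos. }
  assert (Nc : ~ In c l) by (intros I; apply N; auto).
  pose proof (proj1 (Cmod_gt_0 _) N) as PF.
  apply (le_of_pow_le _ _ (Cmod (F c)) M); auto.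
  { apply Rmult_le_pos; lra. }
  { apply Rmult_le_pos; lra. }
  intros n. rewrite !Rpow_mult_distr.
  pose (H := fun z => (F z ^ S n * / (zprod l z ^ n))%C).
  assert (X : Cmod (H c) <= M ^ S n * / m ^ n).
  { apply center_max with R0; auto.
    - intros z Hz. destruct (classic (In z l)) as [I|NI].
      + destruct (zprod_factor l z ND I) as [p [P1 [P2 P3]]].
        destruct (HF z Hz) as [Q [HQ K]].
        destruct (ccont_neq0 p z (P2 z) P3) as [d [Hd P4]].
        (* At a zero, [F w = (w - z) * Q w] and [zprod l w = (w - z) * p w]. Of the [n + 1] factors
           [w - z] upstairs [n] cancel, and the last one is that of the difference quotient. The
           value [H z] is 0 whatever the inverse of 0 is. *)
        apply cdiff_local with (fun w => Q w ^ S n * / (p w ^ n))%C d; auto.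
        * apply (ccont_mult (fun w => Q w ^ S n)%C (fun w => / p w ^ n)%C).
          -- now apply ccont_pow.
          -- apply (ccont_inv (fun w => p w ^ n)%C).
             ++ now apply ccont_pow.
             ++ now apply Cpow_nz.
        * intros w Hw. unfold H. rewrite (HZ z I).
          destruct (classic (w = z)) as [->|Nw].
          { rewrite (HZ z I), !Cpow_S. ring. }
          assert (p w <> RtoC 0).
          { apply Cmod_neq0. specialize (P4 w Hw). pose proof (Cmod_ge_0 (p z)). lra. }
          rewrite (K w), P1, (HZ z I).
          replace (0 + Q w * (w - z))%C with ((w - z) * Q w)%C by ring.
          replace (0 ^ S n * / zprod l z ^ n)%C with (RtoC 0) by (rewrite Cpow_S; ring).
          rewrite !Cpow_S, !Cpow_mult_l.
          field. split; apply Cpow_nz; auto. now apply Csub_neq_0.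
      + apply (cdiff_mult (fun z => F z ^ S n)%C (fun z => / zprod l z ^ n)%C).
        * apply cdiff_pow. auto.
        * apply (cdiff_inv (fun z => zprod l z ^ n)%C).
          -- apply cdiff_pow, cdiff_zprod.
          -- now apply Cpow_nz, zprod_neq_0.
    - intros z Hz. specialize (Hp z Hz). specialize (HM z Hz).
      assert (NZ : (zprod l z ^ n)%C <> RtoC 0).
      { apply Cpow_nz, Cmod_neq0. lra. }
      unfold H. rewrite Cmod_mult, Cmod_inv, !Cmod_pow by auto.
      apply Rmult_le_compat.
      + apply pow_le, Cmod_ge_0.
      + apply Rlt_le, Rinv_0_lt_compat, pow_lt. lra.
      + apply pow_incr. split; [apply Cmod_ge_0|auto].
      + apply Rinv_le_contravar; [now apply pow_lt|].
        apply pow_incr. lra. }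
  assert (NZ : zprod l c <> RtoC 0) by now apply zprod_neq_0.
  pose proof (proj1 (Cmod_gt_0 _) NZ) as PZ.
  unfold H in X. rewrite Cmod_mult, Cmod_inv, !Cmod_pow in X by now apply Cpow_nz.
  pose proof (pow_lt _ n Hm) as Y1. pose proof (pow_lt _ n PZ) as Y2.
  set (u := m ^ n) in *. set (v := Cmod (zprod l c) ^ n) in *.
  apply Rmult_le_compat_r with (r := u * v) in X; [|nra].
  replace (Cmod (F c) ^ S n * / v * (u * v)) with (Cmod (F c) ^ S n * u) in X
    by (field; lra).
  replace (M ^ S n * / u * (u * v)) with (M ^ S n * v) in X by (field; lra).
  simpl in X. lra.
Qed.

(** A Schwarz lemma: [F - F a] has the single prescribed zero [a], and the circle of radius
    [3 * R0 / 4] about [z] stays in the disc and at distance at least [R0 / 4] from [a]. *)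
Lemma bounded_lipschitz (F : C -> C) (c : C) (R0 M : R) :
  0 < R0 -> (forall z, Cmod (z - c)%C <= R0 -> cdiff F z) ->
  (forall z, Cmod (z - c)%C <= R0 -> Cmod (F z) <= M) ->
  forall a z, Cmod (a - c)%C <= R0 / 4 -> Cmod (z - c)%C <= R0 / 4 ->
  Cmod (F z - F a)%C * (R0 / 4) <= 2 * M * Cmod (z - a)%C.
Proof.
  intros HR HF HM a z Ha Hz.
  assert (In_disc : forall w, Cmod (w - z)%C <= 3 * R0 / 4 -> Cmod (w - c)%C <= R0).
  { intros w Hw. pose proof (Cmod_triangle3 w z c). lra. }
  replace (z - a)%C with (zprod (a :: nil) z) by (simpl; ring).
  apply (bound_by_zeros (fun w => F w - F a)%C (a :: nil) z (3 * R0 / 4)).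
  - lra.
  - constructor; [easy|constructor].
  - intros w Hw. apply cdiff_minus; [auto|apply cdiff_const].
  - intros b [->|[]]. ring.
  - intros w Hw. pose proof (Cmod_triangle (F w) (- F a)%C) as T.
    rewrite Cmod_opp in T.
    pose proof (HM w (In_disc w ltac:(lra))). pose proof (HM a ltac:(lra)).
    unfold Cminus. lra.
  - lra.
  - intros w Hw. simpl. rewrite Cmult_1_r.
    pose proof (Cmod_triangle3 w a z). pose proof (Cmod_triangle3 a c z).
    rewrite (Cmod_sub_sym c z) in *. lra.
Qed.

Lemma liouville (F : C -> C) (M : R) :
  (forall z, cdiff F z) -> (forall z, Cmod (F z) <= M) -> forall z, F z = F 0.
Proof.
  intros HF HM z. apply NNPP. intros N.
  pose proof (proj1 (Cmod_gt_0 _) (Csub_neq_0 _ _ N)) as P.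
  set (D := Cmod (F z - F 0)%C) in *.
  pose proof (Cmod_ge_0 (z - 0)%C) as Pz. pose proof (Cmod_ge_0 (F 0)) as P0.
  pose proof (HM 0) as HM0.
  set (t := Cmod (z - 0)%C) in *.
  assert (Q : 0 <= 2 * M * t) by (apply Rmult_le_pos; lra).
  (* The first summand places [z] in the quarter disc; the second makes [D * (R0 / 4)] exceed
     [2 * M * t]. *)
  set (R0 := 4 * t + 4 * ((2 * M * t + 1) / D)).
  assert (Y : 0 < (2 * M * t + 1) / D) by (apply Rdiv_lt_0_compat; lra).
  assert (X := bounded_lipschitz F 0 R0 M ltac:(unfold R0; lra)
                 (fun w _ => HF w) (fun w _ => HM w) 0 z).
  rewrite Cmod_sub_0 in X. fold D t in X.
  specialize (X ltac:(unfold R0; lra) ltac:(unfold R0; lra)).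
  assert (Z : D * (R0 / 4) = D * t + (2 * M * t + 1)) by (unfold R0; field; lra).
  nra.
Qed.

(** * A Harnack-type inequality for zero-free functions *)

Fixpoint separated (s : R) (l : list C) : Prop :=
  match l with
  | nil => True
  | a :: l' => (forall b, In b l' -> s <= Cmod (a - b)%C) /\ separated s l'
  end.

Lemma separated_NoDup (s : R) (l : list C) : 0 < s -> separated s l -> NoDup l.
Proof.
  intros Hs. induction l as [|a l IH]; simpl; intros H; constructor.
  - intros I. destruct H as [H _]. specialize (H a I). rewrite Cmod_sub_0 in H. lra.
  - tauto.
Qed.

(** Newton interpolation: a new node [a] is met by adding a multiple of [zprod l], which vanishes at
    the old nodes. Separation bounds [zprod l a] from below, so [K] depends on [N], [s] and [r]
    only; small data thus have a small interpolant, uniformly in the position of the nodes. *)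
Lemma interpolation (N : nat) (s r : R) : 0 < s -> 0 < r ->
  exists K, 0 <= K /\ forall (c : C) (l : list C) (phi : C -> C) (eps : R),
    length l = N -> separated s l -> 0 <= eps ->
    (forall a, In a l -> Cmod (a - c)%C <= r /\ Cmod (phi a) <= eps) ->
    exists L : C -> C, (forall z, cdiff L z) /\ (forall a, In a l -> L a = phi a) /\
      forall z, Cmod (z - c)%C <= r -> Cmod (L z) <= K * eps.
Proof.
  intros Hs Hr. induction N as [|N [K [HK IH]]].
  - exists 0. split; [lra|]. intros c l phi eps Hl _ He _.
    destruct l; [|easy]. exists (fun _ => RtoC 0). split; [|split].
    + intros z. apply cdiff_const.
    + easy.
    + intros z _. rewrite Cmod_0. lra.
  - pose proof (pow_lt s N Hs) as Ps. pose proof (pow_lt (2 * r) N ltac:(lra)) as Pr.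
    assert (PQ : 0 < (2 * r) ^ N / s ^ N) by now apply Rdiv_lt_0_compat.
    exists (K + (1 + K) * ((2 * r) ^ N / s ^ N)). split; [nra|].
    intros c l phi eps Hl Hsep He Hphi.
    destruct l as [|a l]; [easy|]. injection Hl as Hl. destruct Hsep as [Ha Hsep].
    destruct (IH c l phi eps Hl Hsep He) as [L [L1 [L2 L3]]].
    { intros b Hb. apply Hphi. now right. }
    assert (Lo : s ^ N <= Cmod (zprod l a)).
    { rewrite <- Hl. apply zprod_ge; [lra|auto]. }
    assert (NZ : zprod l a <> RtoC 0) by (apply Cmod_neq0; lra).
    destruct (Hphi a (or_introl eq_refl)) as [Ac Aphi].
    set (q := ((phi a - L a) / zprod l a)%C).
    assert (Hq : Cmod q <= (1 + K) * eps / s ^ N).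
    { unfold q. rewrite Cmod_div by auto. apply Rmult_le_compat.
      - apply Cmod_ge_0.
      - apply Rlt_le, Rinv_0_lt_compat. lra.
      - unfold Cminus. eapply Rle_trans; [apply Cmod_triangle|].
        rewrite Cmod_opp. specialize (L3 a Ac). lra.
      - apply Rinv_le_contravar; lra. }
    exists (fun z => L z + q * zprod l z)%C. split; [|split].
    + intros z. apply cdiff_plus; auto.
      apply (cdiff_mult (fun _ => q) (zprod l)); [apply cdiff_const|apply cdiff_zprod].
    + intros b [<-|Hb].
      * unfold q. field. auto.
      * rewrite (L2 b Hb).
        replace (zprod l b) with (RtoC 0); [ring|].
        destruct (zprod_factor l b) as [p [P1 _]]; auto.
        { now apply separated_NoDup with s. }
        rewrite P1. ring.
    + intros z Hz. eapply Rle_trans; [apply Cmod_triangle|].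
      rewrite Cmod_mult.
      assert (Up : Cmod (zprod l z) <= (2 * r) ^ N).
      { rewrite <- Hl. apply zprod_le. intros b Hb.
        destruct (Hphi b (or_intror Hb)) as [Bc _].
        pose proof (Cmod_triangle3 z c b). rewrite (Cmod_sub_sym c b) in *. lra. }
      assert (X : Cmod q * Cmod (zprod l z) <= (1 + K) * eps / s ^ N * (2 * r) ^ N).
      { apply Rmult_le_compat; auto using Cmod_ge_0. }
      specialize (L3 z Hz).
      replace ((K + (1 + K) * ((2 * r) ^ N / s ^ N)) * eps)
        with (K * eps + (1 + K) * eps / s ^ N * (2 * r) ^ N) by (field; lra).
      lra.
Qed.

(** Otherwise [1 / phi] would be at most [1 / eps] in modulus on the circle, and then at its centre
    too. *)
Lemma small_on_circle (phi : C -> C) (c : C) (r eps : R) :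
  0 < r -> 0 < eps ->
  (forall z, Cmod (z - c)%C <= r -> cdiff phi z /\ phi z <> RtoC 0) ->
  Cmod (phi c) < eps -> exists a, Cmod (a - c)%C = r /\ Cmod (phi a) <= eps.
Proof.
  intros Hr He H Hc. apply NNPP. intros Hno.
  assert (X : Cmod (/ phi c)%C <= / eps).
  { apply (center_max (fun z => / phi z)%C c r); auto.
    - intros z Hz. apply cdiff_inv; apply H; auto.
    - intros z Hz. rewrite Cmod_inv by (apply H; lra).
      apply Rinv_le_contravar; auto. apply Rlt_le, Rnot_le_lt.
      intros Hle. apply Hno. now exists z. }
  assert (N : phi c <> RtoC 0) by (apply H; rewrite Cmod_sub_0; lra).
  rewrite Cmod_inv in X by auto. apply Cmod_gt_0 in N.
  apply Rinv_lt_contravar in Hc; [lra|nra].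
Qed.

(** One point is taken on each circle of radius [d], [2 d], ..., [N d]; points on different circles
    are at least [d] apart. *)
Lemma small_separated_points (phi : C -> C) (c : C) (R0 eps d : R) (N : nat) :
  0 < d -> 0 < eps -> INR N * d <= R0 ->
  (forall z, Cmod (z - c)%C <= R0 -> cdiff phi z /\ phi z <> RtoC 0) ->
  Cmod (phi c) < eps -> exists l, length l = N /\ separated d l /\
    forall a, In a l -> Cmod (a - c)%C <= INR N * d /\ Cmod (phi a) <= eps.
Proof.
  intros Hd He HN H Hc. induction N as [|N IH].
  - exists nil. simpl. intuition.
  - rewrite S_INR in *. pose proof (pos_INR N) as PN.
    destruct IH as [l [L1 [L2 L3]]]; [nra|].
    destruct (small_on_circle phi c ((INR N + 1) * d) eps) as [a [A1 A2]]; auto.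
    { nra. }
    { intros z Hz. apply H. lra. }
    exists (a :: l). split; [simpl; now rewrite L1|]. split.
    + simpl. split; auto. intros b Hb. destruct (L3 b Hb) as [B1 _].
      pose proof (Cmod_triangle3 a b c). lra.
    + intros b [<-|Hb]; [lra|]. destruct (L3 b Hb). split; nra.
Qed.

(* If [phi] is small at [c], then by the minimum principle it is small at some
   point of every circle around [c]; subtracting an interpolating polynomial at
   [N] such points creates [N] zeros, whence a factor [(2/5)^N]. *)
Lemma zero_free_harnack (R0 eta : R) : 0 < R0 -> 0 < eta ->
  exists eps, 0 < eps /\ forall (phi : C -> C) (c : C),
    (forall z, Cmod (z - c)%C <= R0 ->
       cdiff phi z /\ phi z <> RtoC 0 /\ Cmod (phi z) <= 1) ->
    Cmod (phi c) < eps ->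
    forall z, Cmod (z - c)%C <= R0 / 8 -> Cmod (phi z) <= eta.
Proof.
  intros HR Heta.
  (* The zeros lie within [R0 / 4] of [z] and at least [5 * R0 / 8] from the circle of radius
     [7 * R0 / 8] about [z]; the ratio is [2 / 5]. As [phi - L] is at most 2 there,
     [2 * (2 / 5) ^ N] has to stay below [eta / 2]. *)
  destruct (pow_lt_1_zero (2 / 5)) with (y := eta / 4) as [N HN].
  { rewrite Rabs_pos_eq; lra. }
  { lra. }
  specialize (HN N (Nat.le_refl _)).
  rewrite Rabs_pos_eq in HN by (apply pow_le; lra).
  pose proof (pos_INR N) as PN.
  set (d := R0 / (8 * (INR N + 1))).
  assert (Hd : 0 < d) by (apply Rdiv_lt_0_compat; lra).
  assert (HNd : INR N * d <= R0 / 8).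
  { assert ((INR N + 1) * d = R0 / 8) by (unfold d; field; lra). nra. }
  destruct (interpolation N d R0 Hd HR) as [K [HK Interp]].
  (* [K * eps <= 1] bounds [phi - L] by 2 on the circle; [K * eps <= eta / 2] pays for adding [L]
     back at [z]. *)
  set (eps := Rmin 1 (eta / 2) / (K + 1)).
  assert (Pm : 0 < Rmin 1 (eta / 2)) by (apply Rmin_pos; lra).
  assert (He : 0 < eps) by (apply Rdiv_lt_0_compat; lra).
  assert (HKe : K * eps <= Rmin 1 (eta / 2)).
  { assert ((K + 1) * eps = Rmin 1 (eta / 2)) by (unfold eps; field; lra). lra. }
  pose proof (Rmin_l 1 (eta / 2)). pose proof (Rmin_r 1 (eta / 2)).
  exists eps. split; auto. intros phi c Hphi Hc z Hz.
  destruct (small_separated_points phi c R0 eps d N) as [l [L1 [L2 L3]]]; auto.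
  { lra. }
  { intros w Hw. destruct (Hphi w Hw) as [? [? ?]]. auto. }
  destruct (Interp c l phi eps L1 L2) as [L [I1 [I2 I3]]]; [lra| |].
  { intros a Ha. destruct (L3 a Ha). split; lra. }
  assert (In_disc : forall w, Cmod (w - z)%C <= 7 * R0 / 8 -> Cmod (w - c)%C <= R0).
  { intros w Hw. pose proof (Cmod_triangle3 w z c). lra. }
  assert (Z : forall a, In a l -> Cmod (z - a)%C <= R0 / 4).
  { intros a Ha. destruct (L3 a Ha).
    pose proof (Cmod_triangle3 z c a). rewrite (Cmod_sub_sym c a) in *. lra. }
  assert (P5 : 0 < (5 * R0 / 8) ^ N) by (apply pow_lt; lra).
  assert (X : Cmod (phi z - L z)%C * (5 * R0 / 8) ^ N <= 2 * Cmod (zprod l z)).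
  { apply (bound_by_zeros (fun w => phi w - L w)%C l z (7 * R0 / 8)); auto.
    - lra.
    - now apply separated_NoDup with d.
    - intros w Hw. apply cdiff_minus; auto. now apply Hphi, In_disc.
    - intros a Ha. rewrite (I2 a Ha). ring.
    - intros w Hw. assert (Hw' := In_disc w ltac:(lra)).
      destruct (Hphi w Hw') as [_ [_ B]]. specialize (I3 w Hw').
      unfold Cminus. eapply Rle_trans; [apply Cmod_triangle|].
      rewrite Cmod_opp. lra.
    - intros w Hw. rewrite <- L1. apply zprod_ge; [lra|].
      intros a Ha. specialize (Z a Ha). rewrite Cmod_sub_sym in Z.
      pose proof (Cmod_triangle3 w a z). lra. }
  assert (Y : Cmod (zprod l z) <= (2 / 5) ^ N * (5 * R0 / 8) ^ N).
  { rewrite <- Rpow_mult_distr. replace (2 / 5 * (5 * R0 / 8)) with (R0 / 4) by field.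
    rewrite <- L1. now apply zprod_le. }
  assert (W : Cmod (phi z - L z)%C <= 2 * (2 / 5) ^ N).
  { apply Rmult_le_reg_r with ((5 * R0 / 8) ^ N); lra. }
  specialize (I3 z ltac:(lra)).
  pose proof (Cmod_triangle_rev (phi z) (L z)). lra.
Qed.

(** * Montel's theorem *)

Definition extraction (phi : nat -> nat) : Prop := forall k, (phi k < phi (S k))%nat.

Definition infinitely_often (S : nat -> Prop) : Prop :=
  forall n, exists k, (n <= k)%nat /\ S k.

Lemma extraction_mono (phi : nat -> nat) :
  extraction phi -> forall j k, (j < k)%nat -> (phi j < phi k)%nat.
Proof.
  intros H j k L. induction L as [|k L IH]; [apply H|]. specialize (H k). lia.
Qed.

Lemma extraction_comp (phi psi : nat -> nat) :
  extraction phi -> extraction psi -> extraction (fun k => phi (psi k)).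
Proof. intros H1 H2 k. apply extraction_mono; auto. Qed.

Lemma extraction_of_infinitely_often (S : nat -> nat -> Prop) :
  (forall i, infinitely_often (S i)) ->
  exists phi, extraction phi /\ forall k, S k (phi k).
Proof.
  intros HS.
  set (pick := fun i n => proj1_sig (constructive_indefinite_description _ (HS i n))).
  assert (Hpick : forall i n, (n <= pick i n)%nat /\ S i (pick i n)).
  { intros i n. unfold pick. now destruct (constructive_indefinite_description _ (HS i n)). }
  set (phi := fix phi k := match k with
    | O => pick O O | Datatypes.S j => pick (Datatypes.S j) (Datatypes.S (phi j)) end).
  exists phi. split.
  - intros k. destruct (Hpick (Datatypes.S k) (Datatypes.S (phi k))) as [H _]. exact H.
  - intros [|k]; apply Hpick.
Qed.

(** Diagonal argument: [T (S j)] keeps the indices of [T j] that satisfy [B j] if there are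
    infinitely many, and the others if not. The [T i] decrease and remain infinite, so [phi k] in
    [T k] settles each [B i] from [k = S i] on. *)
Lemma extraction_decides (B : nat -> nat -> Prop) :
  exists phi, extraction phi /\ forall i, exists N,
    (forall k, (N <= k)%nat -> B i (phi k)) \/
    (forall k, (N <= k)%nat -> ~ B i (phi k)).
Proof.
  set (T := fix T i : nat -> Prop := match i with
    | O => fun _ => True
    | S j => fun k => T j k /\
        (infinitely_often (fun k => T j k /\ B j k) -> B j k) /\
        (~ infinitely_often (fun k => T j k /\ B j k) -> ~ B j k)
    end).
  assert (HT : forall i, infinitely_often (T i)).
  { induction i as [|i IH].
    - intros n. exists n. now split.
    - destruct (classic (infinitely_often (fun k => T i k /\ B i k))) as [Y|N].
      + intros n. destruct (Y n) as [k [K1 [K2 K3]]]. exists k. simpl. tauto.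
      + pose proof N as N'. apply not_all_ex_not in N'. destruct N' as [n0 N0].
        (* From [n0] on no index of [T i] satisfies [B i], so all of them survive. *)
        intros n. destruct (IH (n0 + n)%nat) as [k [K1 K2]]. exists k.
        split; [lia|]. simpl. split; [auto|]. split; [tauto|].
        intros _ HB. apply N0. exists k. split; [lia|tauto]. }
  destruct (extraction_of_infinitely_often T HT) as [phi [P1 P2]].
  exists phi. split; auto. intros i. exists (S i).
  assert (Mono : forall j k x, (j <= k)%nat -> T k x -> T j x).
  { intros j k x L. induction L as [|k L IH]; auto. intros [H _]. auto. }
  assert (Q : forall k, (S i <= k)%nat -> T (S i) (phi k)).
  { intros k L. apply Mono with k; auto. }
  destruct (classic (infinitely_often (fun k => T i k /\ B i k))) as [Y|N].
  - left. intros k L. now apply Q.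
  - right. intros k L. now apply Q.
Qed.

Lemma exists_step (P : nat -> Prop) (n : nat) :
  ~ P O -> P n -> exists a, ~ P a /\ P (S a).
Proof.
  intros H0. induction n as [|n IH]; intros Hn; [easy|].
  destruct (classic (P n)) as [Y|N]; auto. now exists n.
Qed.

Lemma small_inv_nat (c eps : R) : 0 < eps -> exists n, c / (INR n + 1) < eps.
Proof.
  intros He. destruct (INR_unbounded (c / eps)) as [n Hn].
  exists n. pose proof (pos_INR n).
  apply Rlt_div_l; [lra|]. apply Rlt_div_l in Hn; auto. lra.
Qed.

Definition C_cauchy (u : nat -> C) : Prop :=
  forall eps, 0 < eps -> exists N, forall k l, (N <= k)%nat -> (N <= l)%nat ->
    Cmod (u k - u l)%C <= eps.

(* The extraction decides every inequality [x i k < - M i + a / (b + 1)]. *)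
Lemma bounded_family_extract (x : nat -> nat -> R) (M : nat -> R) :
  (forall i k, Rabs (x i k) <= M i) ->
  exists phi, extraction phi /\ forall i eps, 0 < eps -> exists N,
    forall k l, (N <= k)%nat -> (N <= l)%nat ->
      Rabs (x i (phi k) - x i (phi l)) <= eps.
Proof.
  intros HM.
  set (thr := fun i a b => - M i + INR a / (INR b + 1)).
  destruct (extraction_decides (fun j k =>
    let (i, ab) := Cantor.of_nat j in let (a, b) := Cantor.of_nat ab in
    x i k < thr i a b)) as [phi [P1 P2]].
  exists phi. split; auto. intros i eps He.
  destruct (small_inv_nat 1 eps He) as [b Hb].
  assert (D : forall a, exists N,
    (forall k, (N <= k)%nat -> x i (phi k) < thr i a b) \/
    (forall k, (N <= k)%nat -> ~ x i (phi k) < thr i a b)).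
  { intros a. specialize (P2 (Cantor.to_nat (i, Cantor.to_nat (a, b)))).
    rewrite Cantor.cancel_of_to, Cantor.cancel_of_to in P2. exact P2. }
  pose proof (pos_INR b) as Pb.
  set (P := fun a => exists N, forall k, (N <= k)%nat -> x i (phi k) < thr i a b).
  destruct (INR_unbounded (2 * M i * (INR b + 1))) as [A HA].
  (* [thr i 0 b = - M i] is not an eventual strict upper bound and [thr i A b] is one. At the switch
     from [a] to [S a] the sequence, being decided, ends up in an interval of length
     [1 / (b + 1)]. *)
  destruct (exists_step P A) as [a [Na Ya]].
  - intros [N HN]. specialize (HN N (Nat.le_refl _)). unfold thr in HN. simpl in HN.
    specialize (HM i (phi N)). apply Rabs_le_between in HM.
    unfold Rdiv in HN. rewrite Rmult_0_l in HN. lra.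
  - exists 0%nat. intros k _. specialize (HM i (phi k)). apply Rabs_le_between in HM.
    assert (2 * M i < INR A / (INR b + 1)).
    { apply -> Rlt_div_r; lra. }
    unfold thr. lra.
  - destruct (D a) as [N1 [Y|N]].
    { elim Na. now exists N1. }
    destruct Ya as [N2 Y]. exists (N1 + N2)%nat. intros k l Hk Hl.
    pose proof (N k ltac:(lia)). pose proof (N l ltac:(lia)).
    pose proof (Y k ltac:(lia)). pose proof (Y l ltac:(lia)).
    assert (E : thr i (S a) b = thr i a b + 1 / (INR b + 1)).
    { unfold thr. rewrite S_INR. field. lra. }
    apply Rabs_le. lra.
Qed.

Lemma C_bounded_family_extract (x : nat -> nat -> C) (M : R) :
  (forall i k, Cmod (x i k) <= M) ->
  exists phi, extraction phi /\ forall i, C_cauchy (fun k => x i (phi k)).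
Proof.
  intros HM.
  destruct (bounded_family_extract (fun j k =>
    let (i, q) := Cantor.of_nat j in
    match q with O => Re (x i k) | _ => Im (x i k) end) (fun _ => M))
    as [phi [P1 P2]].
  { intros j k. destruct (Cantor.of_nat j) as [i [|q]].
    - eapply Rle_trans; [apply re_le_Cmod|auto].
    - eapply Rle_trans; [|apply (HM i k)].
      eapply Rle_trans; [apply Rmax_r|apply (Rmax_Cmod (x i k))]. }
  exists phi. split; auto. intros i eps He.
  destruct (P2 (Cantor.to_nat (i, 0%nat)) (eps / 2)) as [N1 H1]; [lra|].
  destruct (P2 (Cantor.to_nat (i, 1%nat)) (eps / 2)) as [N2 H2]; [lra|].
  rewrite Cantor.cancel_of_to in H1, H2.
  exists (N1 + N2)%nat. intros k l Hk Hl.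
  specialize (H1 k l ltac:(lia) ltac:(lia)). specialize (H2 k l ltac:(lia) ltac:(lia)).
  eapply Rle_trans; [apply Cmod_pair_le|].
  change (Rabs (Re (x i (phi k)) - Re (x i (phi l))) +
          Rabs (Im (x i (phi k)) - Im (x i (phi l))) <= eps). lra.
Qed.

Lemma C_complete (u : nat -> C) : C_cauchy u ->
  exists L, forall eps, 0 < eps -> exists N, forall k, (N <= k)%nat ->
    Cmod (u k - L)%C <= eps.
Proof.
  intros H.
  destruct (Rcomplete.R_complete (fun k => Re (u k))) as [a Ha].
  { intros eps He. destruct (H (eps / 2)) as [N HN]; [lra|]. exists N.
    intros k l Hk Hl. unfold R_dist, Rdist.
    eapply Rle_lt_trans; [apply Re_lip|]. specialize (HN k l Hk Hl). lra. }
  destruct (Rcomplete.R_complete (fun k => Im (u k))) as [b Hb].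
  { intros eps He. destruct (H (eps / 2)) as [N HN]; [lra|]. exists N.
    intros k l Hk Hl. unfold R_dist, Rdist.
    eapply Rle_lt_trans; [apply Im_lip|]. specialize (HN k l Hk Hl). lra. }
  exists (a, b). intros eps He.
  destruct (Ha (eps / 2)) as [N1 H1]; [lra|].
  destruct (Hb (eps / 2)) as [N2 H2]; [lra|].
  exists (N1 + N2)%nat. intros k Hk.
  specialize (H1 k ltac:(lia)). specialize (H2 k ltac:(lia)).
  eapply Rle_trans; [apply Cmod_pair_le|].
  change (Rabs (Re (u k) - a) + Rabs (Im (u k) - b) <= eps).
  unfold R_dist, Rdist in *. lra.
Qed.

Lemma uniform_threshold (P : nat -> nat -> Prop) (m : nat) :
  (forall i, exists N, forall k, (N <= k)%nat -> P i k) ->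
  exists N, forall i k, (i <= m)%nat -> (N <= k)%nat -> P i k.
Proof.
  intros H. induction m as [|m [N IH]].
  - destruct (H 0%nat) as [N HN]. exists N. intros i k Hi Hk.
    replace i with 0%nat by lia. auto.
  - destruct (H (S m)) as [N' HN]. exists (N + N')%nat. intros i k Hi Hk.
    destruct (Nat.eq_dec i (S m)) as [->|n].
    + apply HN. lia.
    + apply IH; lia.
Qed.

Lemma near_grid (h t : R) (m : nat) :
  0 <= h -> 0 <= t <= INR m * h ->
  exists i, (i <= m)%nat /\ Rabs (t - INR i * h) <= h.
Proof.
  intros Hh. induction m as [|m IH]; intros Ht.
  - exists 0%nat. split; auto. simpl in *. apply Rabs_le. lra.
  - destruct (Rle_dec t (INR m * h)) as [p|n].
    + destruct IH as [i [I1 I2]]; [lra|]. exists i. split; auto.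
    + exists (S m). split; auto. rewrite S_INR in *. apply Rabs_le. lra.
Qed.

Lemma in_square_disc (rho x y : R) (c : C) :
  Rabs (x - Re c) <= rho -> Rabs (y - Im c) <= rho ->
  Cmod ((x, y) - c)%C <= 2 * rho.
Proof.
  intros Hx Hy. eapply Rle_trans; [apply Cmod_pair_le|].
  change (Rabs (x - Re c) + Rabs (y - Im c) <= 2 * rho). lra.
Qed.

Lemma disc_in_square (rho : R) (z c : C) :
  Cmod (z - c)%C <= rho -> Rabs (Re z - Re c) <= rho /\ Rabs (Im z - Im c) <= rho.
Proof.
  intros H. pose proof (Re_lip z c). pose proof (Im_lip z c). lra.
Qed.

(** A common Lipschitz bound on the disc of radius [R0 / 4] reduces uniform convergence to
    convergence at countably many grid points. The radius [R0 / 8] comes from the square grid: the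
    square around the small disc fits into the disc of radius [R0 / 4]. *)
Lemma montel (F : nat -> C -> C) (c : C) (R0 M : R) : 0 < R0 ->
  (forall k z, Cmod (z - c)%C <= R0 -> cdiff (F k) z /\ Cmod (F k z) <= M) ->
  exists phi g, extraction phi /\ forall eps, 0 < eps -> exists N,
    forall k z, (N <= k)%nat -> Cmod (z - c)%C <= R0 / 8 ->
      Cmod (F (phi k) z - g z)%C < eps.
Proof.
  intros HR HF.
  assert (HM : 0 <= M).
  { eapply Rle_trans; [apply (Cmod_ge_0 (F 0%nat c))|]. apply HF.
    rewrite Cmod_sub_0. lra. }
  assert (Lip : forall k a z, Cmod (a - c)%C <= R0 / 4 -> Cmod (z - c)%C <= R0 / 4 ->
    Cmod (F k z - F k a)%C * (R0 / 4) <= 2 * M * Cmod (z - a)%C).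
  { intros k. apply bounded_lipschitz; auto; intros z Hz; apply HF; auto. }
  set (rho := R0 / 8).
  set (h := fun n : nat => 2 * rho / (INR n + 1)).
  set (pt := fun n i j : nat =>
    (Re c - rho + INR i * h n, Im c - rho + INR j * h n) : C).
  (* Grid points outside the disc get the value 0, which keeps the whole family bounded. *)
  set (x := fun q k : nat =>
    let (n, ij) := Cantor.of_nat q in let (i, j) := Cantor.of_nat ij in
    if Rle_dec (Cmod (pt n i j - c)%C) (R0 / 4) then F k (pt n i j) else RtoC 0).
  destruct (C_bounded_family_extract x M) as [phi [P1 P2]].
  { intros q k. unfold x. destruct (Cantor.of_nat q) as [n ij].
    destruct (Cantor.of_nat ij) as [i j].
    destruct (Rle_dec (Cmod (pt n i j - c)%C) (R0 / 4)) as [p|_].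
    - apply HF. lra.
    - rewrite Cmod_0. auto. }
  assert (Cau : forall eps, 0 < eps -> exists N, forall k l z,
    (N <= k)%nat -> (N <= l)%nat -> Cmod (z - c)%C <= rho ->
    Cmod (F (phi k) z - F (phi l) z)%C <= eps).
  { intros eps He.
    (* A grid point within [2 * h n] and the Lipschitz constant [8 * M / R0] give the oscillation
       [4 * M / (n + 1)]. *)
    destruct (small_inv_nat (4 * M) (eps / 4)) as [n Hn]; [lra|].
    pose proof (pos_INR n) as Pn.
    assert (Hh : 0 < h n) by (apply Rdiv_lt_0_compat; unfold rho; lra).
    assert (Hmh : INR (S n) * h n = 2 * rho).
    { rewrite S_INR. unfold h. field. lra. }
    (* Two nested uses, over columns and over rows, give one index valid at all points of the finite
       grid. *)
    destruct (uniform_threshold (fun i N => forall j k, (j <= S n)%nat -> (N <= k)%nat ->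
      forall l, (N <= l)%nat ->
      Cmod (pt n i j - c)%C <= R0 / 4 ->
      Cmod (F (phi k) (pt n i j) - F (phi l) (pt n i j))%C <= eps / 4) (S n))
      as [N HN].
    { intros i.
      destruct (uniform_threshold (fun j N => forall k l, (N <= k)%nat -> (N <= l)%nat ->
        Cmod (pt n i j - c)%C <= R0 / 4 ->
        Cmod (F (phi k) (pt n i j) - F (phi l) (pt n i j))%C <= eps / 4) (S n))
        as [N HN].
      { intros j.
        destruct (P2 (Cantor.to_nat (n, Cantor.to_nat (i, j))) (eps / 4)) as [N HN];
          [lra|].
        exists N. intros N' LN k l Hk Hl Hp.
        specialize (HN k l ltac:(lia) ltac:(lia)). unfold x in HN.
        rewrite !Cantor.cancel_of_to in HN.
        destruct (Rle_dec (Cmod (pt n i j - c)%C) (R0 / 4)); [auto|contradiction]. }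
      exists N. intros N' LN j k Hj Hk l Hl Hp. apply (HN j N'); auto. }
    exists N. intros k l z Hk Hl Hz.
    destruct (disc_in_square rho z c Hz) as [Zx Zy].
    pose proof (proj1 (Rabs_le_between _ _) Zx). pose proof (proj1 (Rabs_le_between _ _) Zy).
    destruct (near_grid (h n) (Re z - (Re c - rho)) (S n)) as [i [I1 I2]]; [lra|lra|].
    destruct (near_grid (h n) (Im z - (Im c - rho)) (S n)) as [j [J1 J2]]; [lra|lra|].
    set (p := pt n i j).
    assert (Gi : INR i * h n <= 2 * rho).
    { rewrite <- Hmh. apply Rmult_le_compat_r; [lra|]. now apply le_INR. }
    assert (Gj : INR j * h n <= 2 * rho).
    { rewrite <- Hmh. apply Rmult_le_compat_r; [lra|]. now apply le_INR. }
    assert (Gi0 : 0 <= INR i * h n) by (apply Rmult_le_pos; [apply pos_INR|lra]).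
    assert (Gj0 : 0 <= INR j * h n) by (apply Rmult_le_pos; [apply pos_INR|lra]).
    assert (Hp : Cmod (p - c)%C <= R0 / 4).
    { replace (R0 / 4) with (2 * rho) by (unfold rho; field).
      apply in_square_disc; apply Rabs_le; lra. }
    assert (Hzp : Cmod (z - p)%C <= 2 * h n).
    { rewrite Cmod_sub_sym. rewrite Rabs_minus_sym in I2, J2.
      apply in_square_disc.
      - eapply Rle_trans; [right|exact I2]. f_equal. ring.
      - eapply Rle_trans; [right|exact J2]. f_equal. ring. }
    assert (L2 : forall q, Cmod (F q z - F q p)%C <= eps / 4).
    { intros q. specialize (Lip q p z Hp ltac:(unfold rho in Hz; lra)).
      apply Rmult_le_reg_r with (R0 / 4); [lra|].
      eapply Rle_trans; [exact Lip|].
      apply Rle_trans with (2 * M * (2 * h n)).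
      { apply Rmult_le_compat_l; lra. }
      replace (2 * M * (2 * h n)) with (4 * M / (INR n + 1) * (R0 / 4))
        by (unfold h, rho; field; lra).
      apply Rmult_le_compat_r; lra. }
    pose proof (HN i N I1 (Nat.le_refl _) j k J1 Hk l Hl Hp) as G. fold p in G.
    pose proof (L2 (phi k)). pose proof (L2 (phi l)) as L3.
    rewrite Cmod_sub_sym in L3.
    pose proof (Cmod_triangle3 (F (phi k) z) (F (phi k) p) (F (phi l) z)).
    pose proof (Cmod_triangle3 (F (phi k) p) (F (phi l) p) (F (phi l) z)). lra. }
  assert (Lim : forall z, exists L, Cmod (z - c)%C <= rho ->
    forall eps, 0 < eps -> exists N, forall k, (N <= k)%nat ->
      Cmod (F (phi k) z - L)%C <= eps).
  { intros z. destruct (Rle_dec (Cmod (z - c)%C) rho) as [p|n].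
    - destruct (C_complete (fun k => F (phi k) z)) as [L HL].
      + intros eps He. destruct (Cau eps He) as [N HN]. exists N. auto.
      + exists L. auto.
    - exists (RtoC 0). tauto. }
  apply choice in Lim. destruct Lim as [g Hg].
  exists phi, g. split; auto. intros eps He.
  destruct (Cau (eps / 4)) as [N HN]; [lra|].
  exists N. intros k z Hk Hz.
  destruct (Hg z Hz (eps / 4)) as [N' HN']; [lra|].
  specialize (HN k (N + N')%nat z Hk ltac:(lia) Hz). specialize (HN' (N + N')%nat ltac:(lia)).
  pose proof (Cmod_triangle3 (F (phi k) z) (F (phi (N + N')%nat) z) (g z)). lra.
Qed.

(** * Compactness of squares and bounds on discs *)

(** Heine-Borel for a product of two intervals; monotonicity of [Q] in its index lets the largest of
    finitely many local indices serve everywhere. *)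
Lemma square_compact (Q : nat -> C -> Prop) (c : C) (rho : R) :
  (forall m n z, (m <= n)%nat -> Q m z -> Q n z) ->
  (forall z, Rabs (Re z - Re c) <= rho -> Rabs (Im z - Im c) <= rho ->
     exists r n, 0 < r /\ forall w, Cmod (w - z)%C < r -> Q n w) ->
  exists n, forall z, Cmod (z - c)%C <= rho -> Q n z.
Proof.
  intros Mono Hloc.
  (* The cover consists of boxes, and a box of half-side [fst rn] lies in the disc of twice that
     radius. Points off the square receive a dummy gauge. *)
  assert (Hc : forall t : Compactness.Tn 2 R, exists rn : posreal * nat,
    Rabs (fst t - Re c) <= rho -> Rabs (fst (snd t) - Im c) <= rho ->
    forall w : C, Cmod (w - (fst t, fst (snd t)))%C < 2 * fst rn -> Q (snd rn) w).
  { intros [t1 [t2 u]]. cbn [fst snd].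
    destruct (Rle_dec (Rabs (t1 - Re c)) rho) as [p1|n1].
    2:{ exists (mkposreal 1 Rlt_0_1, 0%nat). tauto. }
    destruct (Rle_dec (Rabs (t2 - Im c)) rho) as [p2|n2].
    2:{ exists (mkposreal 1 Rlt_0_1, 0%nat). tauto. }
    destruct (Hloc (t1, t2) p1 p2) as [r [n [Hr H]]].
    assert (Hr2 : 0 < r / 2) by lra.
    exists (mkposreal _ Hr2, n). intros _ _ w Hw. apply H.
    change (Cmod (w - (t1, t2))%C < 2 * (r / 2)) in Hw. lra. }
  apply choice in Hc. destruct Hc as [rn Hrn].
  destruct (NNPP _ (compactness_list 2 (Re c - rho, (Im c - rho, tt))
    (Re c + rho, (Im c + rho, tt)) (fun t => fst (rn t)))) as [l Hl].
  assert (B : exists n, forall t, In t l -> (snd (rn t) <= n)%nat).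
  { clear Hl. induction l as [|t l [n IH]].
    - exists 0%nat. easy.
    - exists (snd (rn t) + n)%nat. intros s [<-|Hs]; [lia|]. specialize (IH s Hs). lia. }
  destruct B as [n Hn]. exists n. intros z Hz.
  destruct (disc_in_square rho z c Hz) as [Zx Zy].
  apply Rabs_le_between in Zx. apply Rabs_le_between in Zy.
  destruct (Hl (Re z, (Im z, tt))) as [[t1 [t2 u]] [T1 [T2 T3]]].
  { simpl. lra. }
  destruct T2 as [U1 [U2 _]]. destruct T3 as [T3 [T4 _]].
  specialize (Hrn (t1, (t2, u))). cbn [fst snd] in Hrn.
  apply Mono with (snd (rn (t1, (t2, u)))); [auto|]. apply Hrn.
  - apply Rabs_le. lra.
  - apply Rabs_le. lra.
  - eapply Rle_lt_trans; [apply Cmod_pair_le|].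
    change (Rabs (Re z - t1) + Rabs (Im z - t2) < 2 * fst (rn (t1, (t2, u)))).
    change (Rabs (Re z - t1) < fst (rn (t1, (t2, u)))) in T3.
    change (Rabs (Im z - t2) < fst (rn (t1, (t2, u)))) in T4. lra.
Qed.

Lemma nat_above (x : R) : exists n, x <= INR n.
Proof. destruct (INR_unbounded x) as [n Hn]. exists n. lra. Qed.

Lemma continuous_bounded_on_disc (F : C -> C) (c : C) (r : R) :
  (forall z, ccont F z) -> exists B, forall z, Cmod (z - c)%C <= r -> Cmod (F z) <= B.
Proof.
  intros HF.
  destruct (square_compact (fun n z => Cmod (F z) <= INR n) c r) as [n Hn].
  - intros m n z L H. apply le_INR in L. lra.
  - intros z _ _. destruct (HF z 1 Rlt_0_1) as [d [Hd K]].
    destruct (nat_above (Cmod (F z) + 1)) as [n Hn].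
    exists d, n. split; auto. intros w Hw. specialize (K w Hw).
    pose proof (Cmod_triangle_rev (F w) (F z)). lra.
  - now exists (INR n).
Qed.

(** * Families omitting a disc *)

(** The cases are whether [psi k w] stays away from 0 along a subsequence. The constant 128 arises
    as [R0 / 2], to have room for a disc about a moving centre, divided by 8 for the Harnack-type
    inequality and by 8 for Montel's theorem. *)
Lemma omitted_disc_normal (F : nat -> C -> C) (w a : C) (R0 rho : R) :
  0 < R0 -> 0 < rho ->
  (forall k z, Cmod (z - w)%C <= R0 -> cdiff (F k) z /\ rho <= Cmod (F k z - a)%C) ->
  exists phi, extraction phi /\
    ((exists g, forall eps, 0 < eps -> exists N, forall k z, (N <= k)%nat ->
        Cmod (z - w)%C <= R0 / 128 -> Cmod (F (phi k) z - g z)%C < eps) \/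
     (forall M, exists N, forall k z, (N <= k)%nat ->
        Cmod (z - w)%C <= R0 / 128 -> M < Cmod (F (phi k) z))).
Proof.
  intros HR Hrho HF.
  set (psi := fun k z => (rho / (F k z - a))%C).
  assert (NZ : forall k z, Cmod (z - w)%C <= R0 -> (F k z - a)%C <> RtoC 0).
  { intros k z Hz. apply Cmod_neq0. destruct (HF k z Hz). lra. }
  assert (Mpsi : forall k z, Cmod (z - w)%C <= R0 ->
    Cmod (psi k z) * Cmod (F k z - a)%C = rho).
  { intros k z Hz. rewrite <- Cmod_mult. unfold psi.
    replace (rho / (F k z - a) * (F k z - a))%C with (RtoC rho) by (field; auto).
    rewrite Cmod_R. apply Rabs_pos_eq. lra. }
  assert (Hpsi : forall k z, Cmod (z - w)%C <= R0 ->
    cdiff (psi k) z /\ psi k z <> RtoC 0 /\ Cmod (psi k z) <= 1).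
  { intros k z Hz. destruct (HF k z Hz) as [D L]. specialize (Mpsi k z Hz).
    pose proof (Cmod_ge_0 (psi k z)). split; [|split].
    - apply (cdiff_mult (fun _ => RtoC rho) (fun z => / (F k z - a))%C).
      + apply cdiff_const.
      + apply (cdiff_inv (fun z => F k z - a)%C); auto.
        apply cdiff_minus; [auto|apply cdiff_const].
    - intros E. rewrite E, Cmod_0 in Mpsi. lra.
    - nra. }
  destruct (classic (exists e, 0 < e /\ infinitely_often (fun k => e <= Cmod (psi k w))))
    as [[e [He Inf]]|Hno].
  - destruct (extraction_of_infinitely_often _ (fun _ => Inf)) as [phi [P1 P2]].
    destruct (zero_free_harnack (R0 / 2) (e / 2)) as [e1 [He1 Har]]; [lra|lra|].
    set (M := Cmod a + rho / e1).
    destruct (montel (fun k => F (phi k)) w (R0 / 16) M) as [th [g [T1 T2]]]; [lra| |].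
    + intros k z Hz. split; [apply HF; lra|].
      (* The inequality is centred at [z] and read backwards: a value below [e1] there would force
         [psi] down to [e / 2] at [w]. *)
      assert (Lo : e1 <= Cmod (psi (phi k) z)).
      { apply Rnot_lt_le. intros Hlt.
        assert (X : Cmod (psi (phi k) w) <= e / 2).
        { apply (Har (psi (phi k)) z); auto.
          - intros v Hv. apply Hpsi. pose proof (Cmod_triangle3 v z w). lra.
          - rewrite Cmod_sub_sym. lra. }
        specialize (P2 k). cbv beta in P2. lra. }
      assert (Hz' : Cmod (z - w)%C <= R0) by lra.
      specialize (Mpsi (phi k) z Hz').
      assert (Cmod (F (phi k) z - a)%C <= rho / e1).
      { apply Rle_div_r; auto. pose proof (Cmod_ge_0 (F (phi k) z - a)%C). nra. }
      pose proof (Cmod_triangle_rev (F (phi k) z) a). unfold M. lra.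
    + exists (fun k => phi (th k)). split; [now apply extraction_comp|].
      left. exists g. intros eps Heps. destruct (T2 eps Heps) as [N HN].
      exists N. intros k z Hk Hz. apply HN; auto. lra.
  (* Here [psi k w] tends to 0 along the whole sequence, so nothing has to be extracted. *)
  - exists (fun k => k). split; [intros k; lia|]. right. intros M.
    pose proof (Cmod_ge_0 a). pose proof (Rabs_pos M).
    set (B := Rabs M + Cmod a + 1).
    assert (HB : 0 < rho / B) by (apply Rdiv_lt_0_compat; unfold B; lra).
    destruct (zero_free_harnack R0 (rho / B)) as [e1 [He1 Har]]; auto.
    assert (Ev : exists N, forall k, (N <= k)%nat -> Cmod (psi k w) < e1).
    { apply NNPP. intros Hn. apply Hno. exists e1. split; auto.
      intros N. apply NNPP. intros Hk. apply Hn. exists N. intros k Lk.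
      apply Rnot_le_lt. intros Hle. apply Hk. now exists k. }
    destruct Ev as [N HN]. exists N. intros k z Hk Hz.
    assert (Hz' : Cmod (z - w)%C <= R0) by lra.
    assert (Sm : Cmod (psi k z) <= rho / B).
    { apply (Har (psi k) w); auto. lra. }
    specialize (Mpsi k z Hz').
    assert (BB : B <= Cmod (F k z - a)%C).
    { apply Rnot_lt_le. intros Hlt.
      assert (rho / B * B = rho) by (field; unfold B; lra).
      pose proof (Cmod_ge_0 (F k z - a)%C).
      assert (Cmod (psi k z) * Cmod (F k z - a)%C <= rho / B * Cmod (F k z - a)%C)
        by now apply Rmult_le_compat_r.
      nra. }
    pose proof (Cmod_triangle (F k z) (- a)%C) as T. rewrite Cmod_opp in T.
    pose proof (Rle_abs M). unfold B, Cminus in BB. lra.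
Qed.

(** * Polynomial growth *)

Lemma Cmod_Defs_Cpow (z : C) (n : nat) : Cmod (Defs.Cpow z n) = Cmod z ^ n.
Proof.
  induction n as [|n IH]; simpl.
  - apply Cmod_1.
  - now rewrite Cmod_mult, IH.
Qed.

Lemma polyval_le (a : nat -> C) (n : nat) :
  exists A, 0 <= A /\ forall z, 1 <= Cmod z -> Cmod (polyval a n z) <= A * Cmod z ^ n.
Proof.
  induction n as [|n [A [HA IH]]].
  - exists (Cmod (a 0%nat)). split; [apply Cmod_ge_0|]. intros z _. simpl. lra.
  - exists (A + Cmod (a (S n))). pose proof (Cmod_ge_0 (a (S n))). split; [lra|].
    intros z Hz. specialize (IH z Hz).
    change (polyval a (S n) z)
      with (polyval a n z + a (S n) * Defs.Cpow z (S n))%C.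
    eapply Rle_trans; [apply Cmod_triangle|].
    rewrite Cmod_mult, Cmod_Defs_Cpow. simpl.
    assert (0 < Cmod z ^ n) by (apply pow_lt; lra).
    assert (A * Cmod z ^ n <= A * (Cmod z * Cmod z ^ n)).
    { apply Rmult_le_compat_l; auto. nra. }
    lra.
Qed.

Lemma poly_proper (P : C -> C) (n : nat) :
  (1 <= n)%nat -> poly_of_degree P n ->
  forall M, exists K, forall z, K < Cmod z -> M < Cmod (P z).
Proof.
  intros Hn [a [Ha HP]] M. destruct n as [|n]; [lia|].
  destruct (polyval_le a n) as [A [HA Hlow]].
  apply Cmod_gt_0 in Ha. set (l := Cmod (a (S n))) in *.
  (* The summand 1 permits [polyval_le]; the quotient makes [l * Cmod z - A] exceed [Rabs M + 1], so
     the leading term outweighs the rest. *)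
  exists (1 + (Rabs M + A + 1) / l). intros z Hz.
  pose proof (Rabs_pos M). pose proof (Rle_abs M).
  assert (0 < (Rabs M + A + 1) / l) by (apply Rdiv_lt_0_compat; lra).
  specialize (Hlow z ltac:(lra)). rewrite HP.
  change (polyval a (S n) z) with (polyval a n z + a (S n) * Defs.Cpow z (S n))%C.
  pose proof (Cmod_triangle_rev (a (S n) * Defs.Cpow z (S n)) (- polyval a n z)) as T.
  rewrite Cmod_opp, Cmod_mult, Cmod_Defs_Cpow in T. fold l in T.
  replace (a (S n) * Defs.Cpow z (S n) - - polyval a n z)%C
    with (polyval a n z + a (S n) * Defs.Cpow z (S n))%C in T by ring.
  simpl (Cmod z ^ S n) in T.
  assert (X : Rabs M + A + 1 < l * Cmod z).
  { assert (l * ((Rabs M + A + 1) / l) = Rabs M + A + 1) by (field; lra). nra. }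
  assert (Y : 1 <= Cmod z ^ n) by (apply pow_R1_Rle; lra).
  assert (Z : Rabs M + 1 <= (l * Cmod z - A) * Cmod z ^ n).
  { apply Rle_trans with ((Rabs M + 1) * 1); [lra|]. apply Rmult_le_compat; lra. }
  lra.
Qed.

(** * Iterates *)

Lemma cdiff_iterate (f : C -> C) (n : nat) :
  (forall z, cdiff f z) -> forall z, cdiff (iterate f n) z.
Proof.
  intros Hf. induction n as [|n IH]; intros z.
  - apply cdiff_id.
  - apply (cdiff_comp f (iterate f n)); auto.
Qed.

Lemma iterate_commute (f g : C -> C) (n : nat) (z : C) :
  (forall z, f (g z) = g (f z)) -> iterate f n (g z) = g (iterate f n z).
Proof.
  intros H. induction n as [|n IH]; [reflexivity|].
  change (f (iterate f n (g z)) = g (f (iterate f n z))). now rewrite IH, H.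
Qed.

(** By Liouville a bounded [g] would be constant, that is, a [polyval] with [n = 0]. *)
Lemma transcendental_unbounded (g : C -> C) (B : R) :
  transcendental_entire g -> exists a, B < Cmod (g a).
Proof.
  intros [Hg Ht]. apply NNPP. intros Hno. apply Ht.
  exists (fun _ => g 0), 0%nat. intros z. simpl.
  apply liouville with B.
  - now apply entire_cdiff.
  - intros v. apply Rnot_lt_le. intros H. apply Hno. now exists v.
Qed.

(** The limit [G] is an arbitrary function, so the local bound goes through one continuous member
    [F N]: three steps of size 1 lead from [F k w] to [F N] at the centre. The square of half-side
    [r / 3] fits into the open disc of radius [r]. A single [n] is both threshold and bound, which
    makes the predicate monotone. *)
Lemma loc_unif_cv_bounded (F : nat -> C -> C) (G : C -> C) (c : C) (r : R) :
  0 < r -> (forall k z, ccont (F k) z) ->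
  loc_unif_cv F G (fun z => Cmod (z - c)%C < r) ->
  exists n, forall k z, (n <= k)%nat -> Cmod (z - c)%C <= r / 3 ->
    Cmod (F k z) <= INR n.
Proof.
  intros Hr HF HG.
  destruct (square_compact
    (fun n z => forall k, (n <= k)%nat -> Cmod (F k z) <= INR n) c (r / 3)) as [n Hn].
  - intros m n z L H k Hk. apply le_INR in L as L'. specialize (H k ltac:(lia)). lra.
  - intros [x y] Hx Hy. pose proof (in_square_disc _ _ _ _ Hx Hy) as Hz.
    destruct (HG (x, y)) as [r1 [Hr1 K]]; [simpl in Hz |- *; lra|].
    destruct (K 1 Rlt_0_1) as [N HN].
    destruct (HF N (x, y) 1 Rlt_0_1) as [d [Hd D]].
    destruct (nat_above (Cmod (F N (x, y)) + 3)) as [n Hn].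
    exists (Rmin r1 d), (N + n)%nat. split; [now apply Rmin_pos|].
    intros w Hw k Hk. pose proof (Rmin_l r1 d). pose proof (Rmin_r r1 d).
    pose proof (HN k w ltac:(lia) ltac:(lra)) as X1.
    pose proof (HN N w ltac:(lia) ltac:(lra)) as X2.
    pose proof (D w ltac:(lra)) as X3.
    rewrite Cmod_sub_sym in X2.
    pose proof (Cmod_triangle3 (F k w) (G w) (F N w)).
    pose proof (Cmod_triangle3 (F k w) (F N w) (F N (x, y))).
    pose proof (Cmod_triangle_rev (F k w) (F N (x, y))).
    rewrite plus_INR. pose proof (pos_INR N). lra.
  - exists n. intros k z Hk Hz. now apply Hn.
Qed.

(** * Pulling the Fatou set and the Bungee set back under [g] *)

Lemma fatou_backward (f g : C -> C) (w : C) :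
  entire f -> transcendental_entire g -> (forall z, f (g z) = g (f z)) ->
  in_Fatou f (g w) -> in_Fatou f w.
Proof.
  intros Hf Hg Hfg [r [Hr Hn]].
  assert (Df : forall n z, cdiff (iterate f n) z).
  { intros n. apply cdiff_iterate. now apply entire_cdiff. }
  assert (Cg : forall z, ccont g z).
  { intros z. apply cdiff_ccont. apply entire_cdiff, Hg. }
  destruct (Cg w (r / 3)) as [del [Hdel Kg]]; [lra|].
  set (R0 := del / 2).
  assert (HR : 0 < R0) by (unfold R0; lra).
  exists (R0 / 128). split; [lra|]. intros m.
  destruct (Hn m) as [phi [P1 [[G HG]|Hinf]]].
  - destruct (loc_unif_cv_bounded _ G (g w) r Hr
                (fun k z => cdiff_ccont _ z (Df (m (phi k)) z)) HG) as [n Bn].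
    (* On the disc of radius [rho] about [a], [Cmod (g _)] still exceeds [n]; an iterate entering it
       would break the bound [Bn]. The shift by [n] below discards the terms not covered by [Bn]. *)
    destruct (transcendental_unbounded g (INR n) Hg) as [a Ha].
    destruct (Cg a (Cmod (g a) - INR n)) as [rho [Hrho Ka]]; [lra|].
    destruct (omitted_disc_normal (fun k => iterate f (m (phi (k + n)%nat))) w a R0 rho)
      as [th [T1 T2]]; auto.
    { intros k z Hz. split; [apply Df|]. apply Rnot_lt_le. intros Hlt.
      specialize (Ka _ Hlt).
      assert (Y : Cmod (g (iterate f (m (phi (k + n)%nat)) z)) <= INR n).
      { rewrite <- iterate_commute by auto. apply Bn; [lia|].
        apply Rlt_le, Kg. unfold R0 in Hz. lra. }
      rewrite Cmod_sub_sym in Ka.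
      pose proof (Cmod_triangle_rev (g a) (g (iterate f (m (phi (k + n)%nat)) z))). lra. }
    exists (fun k => phi (th k + n)%nat). split.
    { intros k. apply (extraction_mono phi P1). specialize (T1 k). lia. }
    assert (Shrink : forall z v, Cmod (v - z)%C < R0 / 128 - Cmod (z - w)%C ->
      Cmod (v - w)%C <= R0 / 128).
    { intros z v Hv. pose proof (Cmod_triangle3 v z w). lra. }
    destruct T2 as [[G' T2]|T2].
    + left. exists G'. intros z Hz. exists (R0 / 128 - Cmod (z - w)%C).
      split; [lra|]. intros eps He. destruct (T2 eps He) as [N HN].
      exists N. intros k v Hk Hv. apply HN; eauto.
    + right. intros z Hz. exists (R0 / 128 - Cmod (z - w)%C).
      split; [lra|]. intros M. destruct (T2 M) as [N HN].
      exists N. intros k v Hk Hv. apply HN; eauto.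
  - exists phi. split; auto. right. intros v Hv.
    destruct (Hinf (g v)) as [r1 [Hr1 K]].
    { assert (Cmod (g v - g w)%C < r / 3) by (apply Kg; unfold R0 in *; lra). lra. }
    destruct (Cg v r1 Hr1) as [d [Hd Kv]].
    exists d. split; auto. intros M.
    (* [g] is at most [B] on the disc of radius [M], so an iterate whose image under [g] exceeds [B]
       lies outside that disc. *)
    destruct (continuous_bounded_on_disc g 0 M Cg) as [B HB].
    destruct (K B) as [N HN]. exists N. intros k u Hk Hu.
    apply Rnot_le_lt. intros Hle.
    specialize (HN k (g u) Hk (Kv u Hu)).
    rewrite iterate_commute in HN by auto.
    assert (Cmod (g (iterate f (m (phi k)) u)) <= B).
    { apply HB. now replace (iterate f (m (phi k)) u - 0)%C
        with (iterate f (m (phi k)) u) by ring. }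
    lra.
Qed.

Lemma bungee_backward (f g h P : C -> C) (w : C) :
  (forall z, ccont g z) -> (forall z, ccont h z) ->
  (forall z, f (g z) = g (f z)) -> (forall z, P (f z) = h (g z)) ->
  (forall M, exists K, forall z, K < Cmod z -> M < Cmod (P z)) ->
  in_BU f (g w) -> in_BU f w.
Proof.
  intros Cg Ch Hfg HP Prop_P [NI NK]. split.
  - intros HI. apply NI. intros M. apply NNPP. intros Hno.
    (* A value of [h] above [B] is taken only outside the disc of radius [M]. The identity
       [P (f z) = h (g z)] spends one application of [f], so iterate [S n] of [w] controls iterate
       [n] of [g w]. *)
    destruct (continuous_bounded_on_disc h 0 M Ch) as [B HB].
    destruct (Prop_P B) as [K HK]. destruct (HI K) as [N HN].
    apply Hno. exists N. intros n Hn. apply Rnot_le_lt. intros Hle.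
    assert (X := HK _ (HN (S n) ltac:(lia))).
    change (iterate f (S n) w) with (f (iterate f n w)) in X.
    rewrite HP, <- iterate_commute in X by auto.
    assert (Cmod (h (iterate f n (g w))) <= B).
    { apply HB. now replace (iterate f n (g w) - 0)%C with (iterate f n (g w)) by ring. }
    lra.
  - intros [R0 [HR H]]. apply NK.
    destruct (continuous_bounded_on_disc g 0 R0 Cg) as [B HB].
    exists (Rabs B + 1). split; [pose proof (Rabs_pos B); lra|]. intros n.
    rewrite iterate_commute by auto.
    assert (Cmod (g (iterate f n w)) <= B).
    { apply HB. now replace (iterate f n w - 0)%C with (iterate f n w) by ring. }
    pose proof (Rle_abs B). lra.
Qed.

Theorem theorem7 (f g h P : C -> C) :
  transcendental_entire f -> transcendental_entire g ->
  (forall z, f (g z) = g (f z)) ->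
  transcendental_entire h ->
  (exists n : nat, (2 <= n)%nat /\ poly_of_degree P n) ->
  (forall z, P (f z) = h (g z)) ->
  forall z0 : C, in_Fatou f z0 -> in_BU f z0 ->
  forall w : C, g w = z0 -> in_Fatou f w /\ in_BU f w.
Proof.
  intros Hf Hg Hfg Hh [n [Hn HPn]] HP z0 HF HBU w <-. split.
  - apply fatou_backward with g; auto. apply Hf.
  - apply bungee_backward with g h P; auto.
    + intros z. apply cdiff_ccont, entire_cdiff, Hg.
    + intros z. apply cdiff_ccont, entire_cdiff, Hh.
    + apply poly_proper with n; auto. lia.
Qed.
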